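(* Let $(TM,\lambda)$ be an EAP-space and let $\mathring D=(\mathring\Gamma^{\alpha}_{\mu\nu},\mathring\Gamma^{a}_{b\nu},\mathring C^{\alpha}_{\mu c},\mathring C^{a}_{bc})$ be its natural metric $d$-connection. There exists a unique $d$-connection $D=(\Gamma^{\alpha}_{\mu\nu},\Gamma^{a}_{b\nu},C^{\alpha}_{\mu c},C^{a}_{bc})$ on $TM$ such that, for every $i=1,\dots,n$, $$\lambda_i^{\alpha}{}_{|\mu}=\lambda_i^{\alpha}{}_{||c}=\lambda_i^{a}{}_{|\mu}=\lambda_i^{a}{}_{||c}=0,$$ where $|$ and $||$ are the $h$- and $v$-covariant derivatives with respect to $D$. Consequently $D$ is a metric $d$-connection (i.e. $g_{\alpha\beta|\mu}=g_{\alpha\beta||c}=g_{ab|\mu}=g_{ab||c}=0$). It is given by $$\Gamma^{\alpha}_{\mu\nu}=\mathring\Gamma^{\alpha}_{\mu\nu}+\lambda_i^{\alpha}\,\lambda_{i\mu\overset{\circ}{|}\nu},\qquad \Gamma^{a}_{b\nu}=\mathring\Gamma^{a}_{b\nu}+\lambda_i^{a}\,\lambda_{ib\overset{\circ}{|}\nu},$$ $$C^{\alpha}_{\mu c}=\mathring C^{\alpha}_{\mu c}+\lambda_i^{\alpha}\,\lambda_{i\mu\overset{\circ}{||}c},\qquad C^{a}_{bc}=\mathring C^{a}_{bc}+\lambda_i^{a}\,\lambda_{ib\overset{\circ}{||}c},$$ with summation over $i$, where $\overset{\circ}{|}$ and $\overset{\circ}{||}$ are the $h$- and $v$-covariant derivatives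 with respect to $\mathring D$.
   Context: Let $M$ be a smooth paracompact $n$-manifold, $TM$ its tangent bundle with induced local coordinates $(x^\mu,y^a)$, and $N=(N^a_\mu(x,y))$ a given nonlinear connection on $TM$. Greek indices denote horizontal and Latin indices vertical components; both run over $1,\dots,n$; repeated indices (including the mesh index $i$) are summed. Put $\dot\partial_a=\partial/\partial y^a$, $\delta_\mu=\partial/\partial x^\mu-N^a_\mu\dot\partial_a$; $(\delta_\mu,\dot\partial_a)$ is the adapted frame of the splitting $T_u(TM)=H_u\oplus V_u$ ($u\in TM\setminus\{0\}$). A $d$-connection is a linear connection $D$ on $TM$ that preserves by parallelism the horizontal and the vertical distribution; its coefficients are defined by $D_{\delta_\nu}\delta_\mu=\Gamma^\alpha_{\mu\nu}\delta_\alpha$, $D_{\delta_\nu}\dot\partial_b=\Gamma^a_{b\nu}\dot\partial_a$, $D_{\dot\partial_c}\delta_\mu=C^\alpha_{\mu c}\delta_\alpha$, $D_{\dot\partial_c}\dot\partial_b=C^a_{bc}\dot\partial_a$. Its $h$- and $v$-covariant derivatives are, for $d$-tensors, $T^{\alpha a}{}_{\beta b|\mu}=\delta_\mu T^{\alpha a}_{\beta b}+T^{\epsilon a}_{\beta b}\Gamma^\alpha_{\epsilon\mu}+T^{\alpha d}_{\beta b}\Gamma^a_{d\mu}-T^{\alpha a}_{\epsilon b}\Gamma^\epsilon_{\beta\mu}-T^{\alpha a}_{\beta d}\Gamma^d_{b\mu}$ and $T^{\alpha a}{}_{\beta b||c}=\dot\partial_cT^{\alpha a}_{\beta b}+T^{\epsilon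 a}_{\beta b}C^\alpha_{\epsilon c}+T^{\alpha d}_{\beta b}C^a_{dc}-T^{\alpha a}_{\epsilon b}C^\epsilon_{\beta c}-T^{\alpha a}_{\beta d}C^d_{bc}$, and similarly for other types. EAP-space $(TM,\lambda)$: $TM$ with the nonlinear connection $N$ and $n$ vector fields $\lambda_i=\lambda_i^\alpha\delta_\alpha+\lambda_i^a\dot\partial_a$ ($i=1,\dots,n$) defined globally on $TM$ such that the $n$ horizontal parts $\lambda_i^\alpha\delta_\alpha$ are linearly independent and the $n$ vertical parts $\lambda_i^a\dot\partial_a$ are linearly independent. $(\lambda_{i\alpha})$ and $(\lambda_{ia})$ denote the inverse matrices of $(\lambda_i^\alpha)$, $(\lambda_i^a)$: $\lambda_i^\alpha\lambda_{i\beta}=\delta^\alpha_\beta$, $\lambda_i^\alpha\lambda_{j\alpha}=\delta_{ij}$, $\lambda_i^a\lambda_{ib}=\delta^a_b$, $\lambda_i^a\lambda_{ja}=\delta_{ij}$. The $hv$-metric is $g_{\alpha\beta}=\lambda_{i\alpha}\lambda_{i\beta}$, $g_{ab}=\lambda_{ia}\lambda_{ib}$, with inverses $g^{\alpha\beta}=\lambda_i^\alpha\lambda_i^\beta$, $g^{ab}=\lambda_i^a\lambda_i^b$. The natural metric $d$-connection $\mathring D$ is given by $\mathring\Gamma^\alpha_{\mu\nu}=\frac12g^{\alpha\epsilon}(\delta_\mu g_{\epsilon\nu}+\delta_\nu g_{\epsilon\mu}-\delta_\epsilon g_{\mu\nu})$, $\mathring\Gamma^a_{b\nu}=\dot\partial_bN^a_\nu+\frac12g^{ac}(\delta_\nu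 g_{bc}-g_{dc}\dot\partial_bN^d_\nu-g_{bd}\dot\partial_cN^d_\nu)$, $\mathring C^\alpha_{\mu c}=\frac12g^{\alpha\epsilon}\dot\partial_cg_{\mu\epsilon}$, $\mathring C^a_{bc}=\frac12g^{ad}(\dot\partial_bg_{dc}+\dot\partial_cg_{db}-\dot\partial_dg_{bc})$; it is metric. *)

(* Defs.v *)
From HB Require Import structures.
From mathcomp Require Import all_boot all_order all_algebra.
From mathcomp Require Import all_classical all_reals all_analysis.
Set Implicit Arguments.
Unset Strict Implicit.
Unset Printing Implicit Defensive.
Import Order.TTheory GRing.Theory Num.Theory.
Import numFieldNormedType.Exports.
Local Open Scope classical_set_scope.
Local Open Scope ring_scope.

Section Smoothness.
Context {R : realType} {E F : normedModType R}.

(* U is open in all uses; smoothness quantifies over every order k, so Ck asks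
   that all iterated directional derivatives be differentiable. *)
Fixpoint Ck (k : nat) (U : set E) (f : E -> F) : Prop :=
  match k with
  | 0 => forall x, U x -> {for x, continuous f}
  | k'.+1 => (forall x, U x -> differentiable f x) /\
             (forall e : E, Ck k' U ('D_e f))
  end.

Definition smooth_on (U : set E) (f : E -> F) : Prop := forall k, Ck k U f.

Definition smooth_near (x : E) (f : E -> F) : Prop :=
  exists U : set E, [/\ open U, U x & smooth_on U f].

End Smoothness.

(* Charts on a set P modelled on E: coord i is the coordinate map of the chart
   i, defined on dom i; param i is its inverse, defined on coord i @` dom i;
   chart_at chooses a chart around each point.
   A tangent vector at p is represented by its components in chart_at p, so
   every tangent space is the vector space E, and a vector field is a function
   P -> E. Its components in another chart are obtained with tcomp. *)
Record charts (R : realType) (E : normedModType R) (P : Type) := Charts {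
  chart : Type;
  dom : chart -> set P;
  coord : chart -> P -> E;
  param : chart -> E -> P;
  chart_at : P -> chart }.

Section Charts.
Context {R : realType} {E : normedModType R} {P : Type}.
Variable A : charts E P.

Definition transition (i j : chart A) : E -> E := coord j \o param i.

Definition here (u : P) : E := coord (chart_at A u) u.

Definition tvec (i : chart A) (u : P) (w : E) : E :=
  'd (transition i (chart_at A u)) (coord i u) w.

Definition tcomp (i : chart A) (u : P) (v : E) : E :=
  'd (transition (chart_at A u) i) (here u) v.

Definition near_point (u : P) (Q : P -> Prop) : Prop :=
  \forall z \near here u, Q (param (chart_at A u) z).

Definition smooth_at (u : P) (f : P -> R) : Prop :=
  smooth_near (here u) (f \o param (chart_at A u) : E -> R).

Definition smooth_field_at (u : P) (X : P -> E) : Prop :=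
  smooth_near (here u)
    (fun z => let w := param (chart_at A u) z in tcomp (chart_at A u) w (X w)).

(* v f, for a tangent vector v at u *)
Definition dirder (u : P) (v : E) (f : P -> R) : R :=
  'd (f \o param (chart_at A u) : E -> R) (here u) v.

(* A linear connection over the open set W: D u v Y is the derivative at u of
   the vector field Y along the tangent vector v at u. Only the values at
   points u of W and at fields Y smooth near u are meaningful. *)
Definition linear_connection (W : set P) (D : P -> E -> (P -> E) -> E) : Prop :=
  [/\ forall u (a : R) v w Y, W u -> smooth_field_at u Y ->
        D u (a *: v + w) Y = a *: D u v Y + D u w Y,
      forall u v Y Z, W u -> smooth_field_at u Y -> smooth_field_at u Z ->
        D u v (fun w => Y w + Z w) = D u v Y + D u v Z,
      forall u v f Y, W u -> smooth_at u f -> smooth_field_at u Y ->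
        D u v (fun w => f w *: Y w) = dirder u v f *: Y u + f u *: D u v Y,
      forall u v Y Z, W u -> smooth_field_at u Y -> smooth_field_at u Z ->
        near_point u (fun w => Y w = Z w) -> D u v Y = D u v Z
    & forall u X Y, W u -> smooth_field_at u X -> smooth_field_at u Y ->
        smooth_field_at u (fun w => D w (X w) Y)].

Definition same_connection (W : set P) (D D' : P -> E -> (P -> E) -> E) : Prop :=
  forall u v Y, W u -> smooth_field_at u Y -> D u v Y = D' u v Y.

End Charts.

Definition paracompact (T : topologicalType) : Prop :=
  forall U : set (set T), (forall A, U A -> open A) ->
    \bigcup_(A in U) A = setT ->
  exists V : set (set T),
    [/\ forall B, V B -> open B,
        \bigcup_(B in V) B = setT,
        forall B, V B -> exists2 A, U A & B `<=` A
      & forall x : T, exists2 O : set T, nbhs x O &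
          finite_set [set B | V B /\ B `&` O !=set0]].

Definition smooth_charts (R : realType) (E : normedModType R)
    (T : topologicalType) (A : charts E T) : Prop :=
  [/\ forall i : chart A, open (dom i) /\ open (coord i @` dom i),
      forall p, dom (chart_at A p) p,
      forall (i : chart A) p, dom i p ->
        param i (coord i p) = p /\ {for p, continuous (coord i)},
      forall (i : chart A) x, (coord i @` dom i) x ->
        {for x, continuous (param i)}
    & forall i j : chart A,
        smooth_on (coord i @` (dom i `&` dom j)) (transition i j)].

Record manifold (R : realType) (n : nat) := Manifold {
  space :> topologicalType;
  atlas : charts 'rV[R]_n space;
  manifold_hausdorff : hausdorff_space space;
  manifold_paracompact : paracompact space;
  manifold_smooth : smooth_charts atlas }.

Section TangentBundle.
Context {R : realType} {n : nat}.
Variable M : manifold R n.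

Record tangent := Tangent { base : M; fibre : 'rV[R]_n }.

(* induced coordinates (x, y) *)
Definition tangent_charts : charts ('rV[R]_n * 'rV[R]_n)%type tangent :=
  {| chart := chart (atlas M);
     dom := fun i => base @^-1` dom i;
     coord := fun i u => (coord i (base u), tcomp i (base u) (fibre u));
     param := fun i z =>
       Tangent (param i z.1) (tvec i (param i z.1) z.2);
     chart_at := fun u => chart_at (atlas M) (base u) |}.

Definition slit : set tangent := [set u | fibre u != 0].

End TangentBundle.

Arguments slit {R n} M _.

Section AdaptedFrame.
Context {R : realType} {n : nat} {M : manifold R n}.
Let TM := tangent M.
Let A := tangent_charts M.
Let TTM := ('rV[R]_n * 'rV[R]_n)%type.

(* The coefficients N^a_mu are given by N c a mu in the chart c. *)
Variable N : chart A -> 'I_n -> 'I_n -> TM -> R.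

Definition delta (c : chart A) (mu : 'I_n) (u : TM) : TTM :=
  tvec c u (delta_mx 0 mu, - \row_a N c a mu u).

Definition vdot (c : chart A) (a : 'I_n) (u : TM) : TTM :=
  tvec c u (0, delta_mx 0 a).

Definition hspace (c : chart A) (u : TM) : set TTM :=
  [set v | exists xi : 'I_n -> R, v = \sum_mu xi mu *: delta c mu u].

Definition vspace (c : chart A) (u : TM) : set TTM :=
  [set v | exists eta : 'I_n -> R, v = \sum_a eta a *: vdot c a u].

(* The frames (delta c mu) of overlapping charts must span the same horizontal
   space, which is the transformation law of the coefficients. *)
Definition nonlinear_connection (W : set TM) : Prop :=
  (forall c a mu u, W u -> dom c u -> smooth_at A u (N c a mu)) /\
  (forall c c' u, W u -> dom c u -> dom c' u -> hspace c u = hspace c' u).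

(* Components of v in the adapted frame; d/dx^mu = delta_mu + N^a_mu d/dy^a. *)
Definition hcomp (c : chart A) (u : TM) (v : TTM) (al : 'I_n) : R :=
  (tcomp c u v).1 0 al.

Definition vcomp (c : chart A) (u : TM) (v : TTM) (a : 'I_n) : R :=
  (tcomp c u v).2 0 a + \sum_mu N c a mu u * (tcomp c u v).1 0 mu.

Definition hpart (u : TM) (v : TTM) : TTM :=
  let c := chart_at A u in \sum_al hcomp c u v al *: delta c al u.

Definition vpart (u : TM) (v : TTM) : TTM :=
  let c := chart_at A u in \sum_a vcomp c u v a *: vdot c a u.

Definition dh (c : chart A) (mu : 'I_n) (f : TM -> R) (u : TM) : R :=
  dirder A u (delta c mu u) f.

Definition dv (c : chart A) (a : 'I_n) (f : TM -> R) (u : TM) : R :=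
  dirder A u (vdot c a u) f.

(* A d-connection preserves both distributions: covariant derivatives of
   horizontal fields are horizontal, and of vertical fields vertical. *)
Definition d_connection (W : set TM) (D : TM -> TTM -> (TM -> TTM) -> TTM) : Prop :=
  [/\ linear_connection A W D,
      forall u v Y, W u -> smooth_field_at A u Y ->
        near_point A u (fun w => hspace (chart_at A w) w (Y w)) ->
        hspace (chart_at A u) u (D u v Y)
    & forall u v Y, W u -> smooth_field_at A u Y ->
        near_point A u (fun w => vspace (chart_at A w) w (Y w)) ->
        vspace (chart_at A u) u (D u v Y)].

(* Gamma^al_{mu nu} = Gh al mu nu, Gamma^a_{b nu} = Gv a b nu,
   C^al_{mu c} = Ch al mu c, C^a_{bc} = Cv a b c; the last index is the
   direction of differentiation. *)
Record coefs := Coefs {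
  Gh : 'I_n -> 'I_n -> 'I_n -> TM -> R;
  Gv : 'I_n -> 'I_n -> 'I_n -> TM -> R;
  Ch : 'I_n -> 'I_n -> 'I_n -> TM -> R;
  Cv : 'I_n -> 'I_n -> 'I_n -> TM -> R }.

Definition coefs_of (D : TM -> TTM -> (TM -> TTM) -> TTM) (k : chart A) : coefs :=
  {| Gh := fun al mu nu u => hcomp k u (D u (delta k nu u) (delta k mu)) al;
     Gv := fun a b nu u => vcomp k u (D u (delta k nu u) (vdot k b)) a;
     Ch := fun al mu c u => hcomp k u (D u (vdot k c u) (delta k mu)) al;
     Cv := fun a b c u => vcomp k u (D u (vdot k c u) (vdot k b)) a |}.

(* Covariant derivatives of tensors with one upper, one lower and two lower
   indices; d is the derivation and G al eps the connection coefficients in the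
   chosen direction. *)
Definition cov_up (d : (TM -> R) -> TM -> R) (G : 'I_n -> 'I_n -> TM -> R)
    (T : 'I_n -> TM -> R) (al : 'I_n) (u : TM) : R :=
  d (T al) u + \sum_eps T eps u * G al eps u.

Definition cov_low (d : (TM -> R) -> TM -> R) (G : 'I_n -> 'I_n -> TM -> R)
    (T : 'I_n -> TM -> R) (be : 'I_n) (u : TM) : R :=
  d (T be) u - \sum_eps T eps u * G eps be u.

Definition cov_low2 (d : (TM -> R) -> TM -> R) (G : 'I_n -> 'I_n -> TM -> R)
    (T : 'I_n -> 'I_n -> TM -> R) (be ga : 'I_n) (u : TM) : R :=
  d (T be ga) u - \sum_eps T eps ga u * G eps be u
                - \sum_eps T be eps u * G eps ga u.

Section Directions.
Variables (k : chart A) (K : coefs).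

(* h- and v-covariant derivatives (_h and _v) of a horizontal or vertical upper
   index (hup, vup), of a lower index (hlow, vlow), and of two lower indices *)
Definition hup_h T al mu := cov_up (dh k mu) (fun al eps => Gh K al eps mu) T al.
Definition hup_v T al c := cov_up (dv k c) (fun al eps => Ch K al eps c) T al.
Definition vup_h T a mu := cov_up (dh k mu) (fun a d => Gv K a d mu) T a.
Definition vup_v T a c := cov_up (dv k c) (fun a d => Cv K a d c) T a.

Definition hlow_h T be mu := cov_low (dh k mu) (fun al eps => Gh K al eps mu) T be.
Definition hlow_v T be c := cov_low (dv k c) (fun al eps => Ch K al eps c) T be.
Definition vlow_h T b mu := cov_low (dh k mu) (fun a d => Gv K a d mu) T b.
Definition vlow_v T b c := cov_low (dv k c) (fun a d => Cv K a d c) T b.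

Definition hlow2_h T al be mu := cov_low2 (dh k mu) (fun al eps => Gh K al eps mu) T al be.
Definition hlow2_v T al be c := cov_low2 (dv k c) (fun al eps => Ch K al eps c) T al be.
Definition vlow2_h T a b mu := cov_low2 (dh k mu) (fun a d => Gv K a d mu) T a b.
Definition vlow2_v T a b c := cov_low2 (dv k c) (fun a d => Cv K a d c) T a b.

End Directions.

Section EAP.
Variable lam : 'I_n -> TM -> TTM.

Definition eap_space (W : set TM) : Prop :=
  [/\ forall i u, W u -> smooth_field_at A u (lam i),
      forall u, W u -> free [seq hpart u (lam i u) | i : 'I_n]
    & forall u, W u -> free [seq vpart u (lam i u) | i : 'I_n]].

Section Components.
Variable k : chart A.

Definition lamh (i al : 'I_n) (u : TM) : R := hcomp k u (lam i u) al.
Definition lamv (i a : 'I_n) (u : TM) : R := vcomp k u (lam i u) a.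

(* lambda_{i alpha} and lambda_{i a} *)
Definition lamh_inv (i al : 'I_n) (u : TM) : R :=
  invmx (\matrix_(j, be) lamh j be u) al i.
Definition lamv_inv (i a : 'I_n) (u : TM) : R :=
  invmx (\matrix_(j, b) lamv j b u) a i.

Definition gh (al be : 'I_n) (u : TM) : R := \sum_i lamh_inv i al u * lamh_inv i be u.
Definition gv (a b : 'I_n) (u : TM) : R := \sum_i lamv_inv i a u * lamv_inv i b u.
Definition gh_inv (al be : 'I_n) (u : TM) : R := \sum_i lamh i al u * lamh i be u.
Definition gv_inv (a b : 'I_n) (u : TM) : R := \sum_i lamv i a u * lamv i b u.

Definition natural : coefs :=
  {| Gh := fun al mu nu u => 2^-1 * \sum_eps gh_inv al eps u *
       (dh k mu (gh eps nu) u + dh k nu (gh eps mu) u - dh k eps (gh mu nu) u);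
     Gv := fun a b nu u => dv k b (N k a nu) u + 2^-1 * \sum_c gv_inv a c u *
       (dh k nu (gv b c) u - \sum_d gv d c u * dv k b (N k d nu) u
                           - \sum_d gv b d u * dv k c (N k d nu) u);
     Ch := fun al mu c u =>
       2^-1 * \sum_eps gh_inv al eps u * dv k c (gh mu eps) u;
     Cv := fun a b c u => 2^-1 * \sum_d gv_inv a d u *
       (dv k b (gv d c) u + dv k c (gv d b) u - dv k d (gv b c) u) |}.

End Components.

Definition parallel_lam (W : set TM) (D : TM -> TTM -> (TM -> TTM) -> TTM) : Prop :=
  forall (k : chart A) u, W u -> dom k u -> forall i j l : 'I_n,
  [/\ hup_h k (coefs_of D k) (lamh k i) j l u = 0,
      hup_v k (coefs_of D k) (lamh k i) j l u = 0,
      vup_h k (coefs_of D k) (lamv k i) j l u = 0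
    & vup_v k (coefs_of D k) (lamv k i) j l u = 0].

Definition metric_connection (W : set TM) (D : TM -> TTM -> (TM -> TTM) -> TTM) : Prop :=
  forall (k : chart A) u, W u -> dom k u -> forall i j l : 'I_n,
  [/\ hlow2_h k (coefs_of D k) (gh k) i j l u = 0,
      hlow2_v k (coefs_of D k) (gh k) i j l u = 0,
      vlow2_h k (coefs_of D k) (gv k) i j l u = 0
    & vlow2_v k (coefs_of D k) (gv k) i j l u = 0].

End EAP.
End AdaptedFrame.

(* Main.v *)
(* Let X_i and V_i be the horizontal and vertical parts of lambda_i. They form a
   global frame, so every field is uniquely Y = sum_i f_i X_i + sum_i g_i V_i,
   and D_v Y := sum_i v(f_i) X_i + sum_i v(g_i) V_i is a connection, visibly a
   d-connection. In a chart, the vanishing of the covariant derivatives of the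
   components of lambda_i says exactly that X_i and V_i are D-parallel; with the
   Leibniz rule this forces the formula for D, hence uniqueness. The
   coefficients are Gamma^alpha_{mu nu} = lambda_i^alpha delta_nu lambda_{i mu},
   and likewise for the other three families. Subtracting the covariant
   derivative of lambda_{i mu} for any other coefficients G and contracting
   with lambda_i^alpha gives Gamma - G, so the four formulas of the theorem
   hold whatever the natural connection is; metricity follows from
   g = lambda^-1 (lambda^-1)^T and the product rule. *)
Require Import Defs.
From HB Require Import structures.
From mathcomp Require Import all_boot all_order all_algebra.
From mathcomp Require Import all_classical all_reals all_analysis.
Set Implicit Arguments.
Unset Strict Implicit.
Unset Printing Implicit Defensive.
Import Order.TTheory GRing.Theory Num.Theory.
Import numFieldNormedType.Exports.
Local Open Scope classical_set_scope.
Local Open Scope ring_scope.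

(* The unqualified name is the coordinate map of [vector]. *)
Local Notation coord := Defs.coord.

(** * Smooth functions *)

Section LocalDifferential.
Context {R : realType} {E F : normedModType R}.

(** The first-order expansion of [f] involves only its values near [x], so it is also one of [g];
    uniqueness of the differential then identifies ['d g x]. *)
Lemma near_eq_diff (f g : E -> F) x : (\forall z \near x, f z = g z) ->
  differentiable f x -> differentiable g x /\ 'd g x = 'd f x :> (E -> F).
Proof.
move=> fg df.
have dg : g \o shift x = cst (g x) + 'd f x +o_ 0 id.
  apply/eqaddoP => _/posnumP[e].
  have /eqaddoP /(_ e%:num) /(_ [gt0 of e%:num]) := diff_locally df.
  apply: filter_app.
  have := fg; rewrite (near_shift 0 x) subr0 => fg0; near=> h.
  rewrite /= -![(_ + _ : _ -> _) _]/(_ + _) -![(- _ : _ -> _) _]/(- _) /=.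
  rewrite -(nbhs_singleton fg) /cst.
  suff -> : g (h + x) = f (h + x) by [].
  by apply/esym; near: h.
have dfg : 'd g x = 'd f x :> (E -> F).
  by apply: diff_unique => //; exact: diff_continuous.
split=> //; apply/diff_locallyP; rewrite dfg; split=> //.
exact: diff_continuous.
Unshelve. all: by end_near. Qed.

Lemma differentiable_linear_comp (G : normedModType R) (L : {linear F -> G}) (f : E -> F) x :
  continuous L -> differentiable f x -> differentiable (L \o f) x.
Proof. by move=> cL df; apply: differentiable_comp => //; exact: linear_differentiable. Qed.

Lemma diff_linear_comp (G : normedModType R) (L : {linear F -> G}) (f : E -> F) x v :
  continuous L -> differentiable f x -> 'd (L \o f) x v = L ('d f x v).
Proof. by move=> cL df; rewrite diff_comp ?diff_lin //; exact: linear_differentiable. Qed.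

Lemma differentiable_comp_linear (G : normedModType R) (L : {linear E -> F}) (f : F -> G) x :
  continuous L -> differentiable f (L x) -> differentiable (f \o L) x.
Proof. by move=> cL df; apply: differentiable_comp => //; exact: linear_differentiable. Qed.

Lemma diff_comp_linear (G : normedModType R) (L : {linear E -> F}) (f : F -> G) x v :
  continuous L -> differentiable f (L x) -> 'd (f \o L) x v = 'd f (L x) (L v).
Proof. by move=> cL df; rewrite diff_comp ?diff_lin //; exact: linear_differentiable. Qed.

End LocalDifferential.

(** * Maps of class C^k on an open set *)

Section Ck.
Context {R : realType}.
Implicit Types E F G : normedModType R.

Lemma Ck_subset E F k (U V : set E) (f : E -> F) :
  V `<=` U -> Ck k U f -> Ck k V f.
Proof.
move=> VU; elim: k f => [|k IH] f /=; first by move=> cf x /VU/cf.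
by move=> [df Df]; split=> [x /VU/df//|e]; exact: IH.
Qed.

Lemma open_near E (U : set E) (P : E -> Prop) x : open U -> U x ->
  (forall z, U z -> P z) -> \forall z \near x, P z.
Proof. by move=> oU Ux UP; apply: filterS (open_nbhs_nbhs (conj oU Ux)). Qed.

(** Since [U] is open, equality on [U] is equality near each of its points; the directional
    derivatives therefore agree on [U] and the induction applies to them. *)
Lemma Ck_eq E F k (U : set E) (f g : E -> F) : open U ->
  (forall x, U x -> f x = g x) -> Ck k U f -> Ck k U g.
Proof.
move=> oU; elim: k f g => [|k IH] f g fg /=.
  move=> cf x Ux; suff : g @ x --> f x by rewrite (fg x Ux).
  by apply: cvg_trans (cf x Ux); apply: near_eq_cvg; exact: open_near Ux fg.
have nfg x Ux := open_near oU Ux fg : \forall z \near x, f z = g z.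
move=> [df Df]; split=> [x Ux|e]; first by case: (near_eq_diff (nfg x Ux) (df x Ux)).
apply: IH (Df e) => x Ux; have [dg dfg] := near_eq_diff (nfg x Ux) (df x Ux).
apply: etrans (deriveE e (df x Ux)) _; apply: etrans _ (esym (deriveE e dg)).
exact: (congr1 (fun h => h e) (esym dfg)).
Qed.

Lemma CkS E F k (U : set E) (f : E -> F) : Ck k.+1 U f -> Ck k U f.
Proof.
elim: k f => [|k IH] f [df Df]; first by move=> x /df/differentiable_continuous.
by split=> // e; exact: IH.
Qed.

Lemma Ck_cst E F k (U : set E) (a : F) : Ck k U (fun=> a).
Proof.
elim: k a => [|k IH] a /=; first by move=> x _; exact: cst_continuous.
split=> [x _|e]; first exact: differentiable_cst.
suff -> : 'D_e (fun=> a) = (fun=> 0) :> (E -> F) by [].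
by apply/funext => x; exact: derive_cst.
Qed.

Lemma Ck_linear E F k (U : set E) (L : {linear E -> F}) :
  continuous L -> Ck k U L.
Proof.
move=> cL; case: k => [|k] /=; first by move=> x _; exact: cL.
split=> [x _|e]; first exact: linear_differentiable.
suff -> : 'D_e L = (fun=> L e) by exact: Ck_cst.
by apply/funext => x; rewrite deriveE ?diff_lin//; exact: linear_differentiable.
Qed.

Lemma Ck_comp_linear E F G k (U : set E) (L : {linear F -> G}) (f : E -> F) :
  open U -> continuous L -> Ck k U f -> Ck k U (L \o f).
Proof.
move=> oU cL; elim: k f => [|k IH] f /=.
  by move=> cf x Ux; apply: continuous_comp; [exact: cf|exact: cL].
move=> [df Df]; have dLf x : U x -> differentiable (L \o f) x.
  by move=> /df; exact: differentiable_linear_comp.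
split=> // e; apply: Ck_eq (IH _ (Df e)) => // x Ux.
by rewrite /= (deriveE e (df x Ux)) [RHS](deriveE e (dLf x Ux)) diff_linear_comp //; exact: df.
Qed.

Lemma Ck_linear_comp E F G k (U : set F) (L : {linear E -> F}) (f : F -> G) :
  open U -> continuous L -> Ck k U f -> Ck k (L @^-1` U) (f \o L).
Proof.
move=> oU cL; have oLU : open (L @^-1` U) by apply: open_comp => // x _; exact: cL.
elim: k f => [|k IH] f /=.
  by move=> cf x Ux; apply: continuous_comp; [exact: cL|exact: cf].
move=> [df Df]; have dfL x : U (L x) -> differentiable (f \o L) x.
  by move=> /df; exact: differentiable_comp_linear.
split=> // e; apply: Ck_eq (IH _ (Df (L e))) => // x Ux.
by rewrite /= (deriveE (L e) (df _ Ux)) [RHS](deriveE e (dfL x Ux)) diff_comp_linear //; exact: df.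
Qed.

Lemma CkD E F k (U : set E) (f g : E -> F) : open U ->
  Ck k U f -> Ck k U g -> Ck k U (fun x => f x + g x).
Proof.
move=> oU; elim: k f g => [|k IH] f g /=.
  by move=> cf cg x Ux; apply: continuousD; [exact: cf|exact: cg].
move=> [df Df] [dg Dg]; split=> [x Ux|e].
  by apply: differentiableD; [exact: df|exact: dg].
apply: Ck_eq (IH _ _ (Df e) (Dg e)) => // x Ux.
have [dfx dgx] := (df x Ux, dg x Ux).
apply: etrans (f_equal2 +%R (deriveE e dfx) (deriveE e dgx)) _.
apply: etrans _ (esym (deriveE e (differentiableD dfx dgx))).
exact: (congr1 (fun h => h e) (esym (diffD dfx dgx))).
Qed.

(** The product rule mixes derivatives with the functions themselves, so the induction also needs
    [f] and [g] at the lower order, which [CkS] supplies. *)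
Lemma CkM E k (U : set E) (f g : E -> R) : open U ->
  Ck k U f -> Ck k U g -> Ck k U (fun x => f x * g x).
Proof.
move=> oU; elim: k f g => [|k IH] f g.
  by move=> cf cg x Ux; apply: continuousM; [exact: cf|exact: cg].
move=> /[dup] /CkS cf [df Df] /[dup] /CkS cg [dg Dg]; split=> [x Ux|e].
  by apply: differentiableM; [exact: df|exact: dg].
apply: Ck_eq (CkD oU (IH _ _ cf (Dg e)) (IH _ _ cg (Df e))) => // x Ux.
have [dfx dgx] := (df x Ux, dg x Ux).
apply: etrans _ (esym (deriveE e (differentiableM dfx dgx))).
apply: etrans _ (esym (congr1 (fun h => h e) (diffM dfx dgx))).
exact: (f_equal2 (fun a b => f x * a + g x * b) (deriveE e dgx) (deriveE e dfx)).
Qed.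

Lemma CkV E k (U : set E) (f : E -> R) : open U ->
  (forall x, U x -> f x != 0) -> Ck k U f -> Ck k U (fun x => (f x)^-1).
Proof.
move=> oU f0; elim: k => [|k IH].
  by move=> cf x Ux; apply: continuousV; [exact: f0|exact: cf].
move=> /[dup] /CkS /IH cf [df Df]; split=> [x Ux|e].
  by apply: differentiableV; [exact: df|exact: f0].
(* The derivative of 1/f is -(1/f)(1/f) f'; written as a product, it falls under the induction
   hypothesis for 1/f at order [k]. *)
apply: Ck_eq (CkM oU (CkM oU (CkM oU cf cf) (@Ck_cst E R k U (-1))) (Df e)) => // x Ux.
have [dfx fx] := (df x Ux, f0 x Ux).
apply: etrans _ (esym (deriveE e (differentiableV dfx fx))).
apply: etrans _ (esym (congr1 (fun h => h e) (diffV dfx fx))).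
by rewrite (deriveE e dfx) mulrN1 -invfM -expr2.
Qed.

End Ck.

(** A finite linear coordinate system, with continuous coordinate forms [crd] and matching vectors
    [cvec]. It serves to test smoothness componentwise and to reduce a varying direction to finitely
    many constant ones. *)
Record coordinates (R : realType) (E : normedModType R) := Coordinates {
  cidx : finType;
  cvec : cidx -> E;
  crd : cidx -> {linear E -> R};
  crd_continuous : forall i, continuous (crd i);
  crdE : forall v, v = \sum_i crd i v *: cvec i }.
Arguments cvec {R E} c i.
Arguments crd {R E} c i.

(** * Maps smooth near a point *)

Section SmoothNear.
Context {R : realType}.
Implicit Types E F G : normedModType R.

Lemma smooth_near_eq E F (x : E) (f g : E -> F) :
  (\forall z \near x, f z = g z) -> smooth_near x f -> smooth_near x g.
Proof.
rewrite -nbhs_nearE nbhsE => -[V [oV Vx] fg] [U [oU Ux sf]].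
exists (U `&` V); split=> [|//|k]; first exact: openI.
apply: Ck_eq (Ck_subset _ (sf k)); [exact: openI | by move=> z [_ /fg] | by move=> z []].
Qed.

Lemma smooth_near_near E F (x : E) (f : E -> F) :
  smooth_near x f -> \forall z \near x, smooth_near z f.
Proof. by move=> [U [oU Ux sf]]; apply: open_near Ux _ => // z Uz; exists U. Qed.

Lemma smooth_near_differentiable E F (x : E) (f : E -> F) :
  smooth_near x f -> differentiable f x.
Proof. by move=> [U [_ Ux /(_ 1%N)[df _]]]; exact: df. Qed.

Lemma smooth_near_derive E F (x : E) (f : E -> F) e :
  smooth_near x f -> smooth_near x ('D_e f).
Proof. by move=> [U [oU Ux sf]]; exists U; split=> // k; have [_] := sf k.+1; apply. Qed.

Lemma smooth_near_cst E F (x : E) (a : F) : smooth_near x (fun=> a).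
Proof. by exists setT; split=> [||k] //; [exact: openT|exact: Ck_cst]. Qed.

Lemma smooth_near_linear E F (x : E) (L : {linear E -> F}) :
  continuous L -> smooth_near x L.
Proof. by exists setT; split=> [||k] //; [exact: openT|exact: Ck_linear]. Qed.

Lemma smooth_near_comp_linear E F G (x : E) (L : {linear F -> G}) (f : E -> F) :
  continuous L -> smooth_near x f -> smooth_near x (L \o f).
Proof. by move=> cL [U [oU Ux sf]]; exists U; split=> // k; exact: Ck_comp_linear. Qed.

Lemma smooth_near_linear_comp E F G (x : E) (L : {linear E -> F}) (f : F -> G) :
  continuous L -> smooth_near (L x) f -> smooth_near x (f \o L).
Proof.
move=> cL [U [oU Ux sf]]; exists (L @^-1` U); split=> // [|k].
  by apply: open_comp => // z _; exact: cL.
exact: Ck_linear_comp.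
Qed.

Lemma smooth_nearD E F (x : E) (f g : E -> F) :
  smooth_near x f -> smooth_near x g -> smooth_near x (fun z => f z + g z).
Proof.
move=> [U [oU Ux sf]] [V [oV Vx sg]]; have oUV := openI oU oV.
exists (U `&` V); split=> // k.
by apply: CkD oUV _ _; [apply: Ck_subset (sf k)|apply: Ck_subset (sg k)] => z [].
Qed.

Lemma smooth_nearM E (x : E) (f g : E -> R) :
  smooth_near x f -> smooth_near x g -> smooth_near x (fun z => f z * g z).
Proof.
move=> [U [oU Ux sf]] [V [oV Vx sg]]; have oUV := openI oU oV.
exists (U `&` V); split=> // k.
by apply: CkM oUV _ _; [apply: Ck_subset (sf k)|apply: Ck_subset (sg k)] => z [].
Qed.

Lemma smooth_nearN E (x : E) (f : E -> R) :
  smooth_near x f -> smooth_near x (fun z => - f z).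
Proof.
move=> sf; have := smooth_nearM (@smooth_near_cst E R x (-1)) sf.
by apply: smooth_near_eq; apply: nearW => z; rewrite mulN1r.
Qed.

Lemma smooth_nearV E (x : E) (f : E -> R) : f x != 0 ->
  smooth_near x f -> smooth_near x (fun z => (f z)^-1).
Proof.
move=> f0 sf; have cf := differentiable_continuous (smooth_near_differentiable sf).
have : \forall z \near x, f z != 0 by exact: cvgr_neq0 cf f0.
case: sf => U [oU Ux sf]; rewrite -nbhs_nearE nbhsE => -[V [oV Vx] Vf]; have oUV := openI oU oV.
exists (U `&` V); split=> // k; apply: CkV => // [z [_ /Vf]//|].
by apply: Ck_subset (sf k) => z [].
Qed.

Lemma smooth_near_sum E F (x : E) I (r : seq I) (P : pred I) (f : I -> E -> F) :
  (forall i, P i -> smooth_near x (f i)) ->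
  smooth_near x (fun z => \sum_(i <- r | P i) f i z).
Proof.
move=> sf; elim: r => [|i r IH].
  apply: smooth_near_eq (smooth_near_cst x 0).
  by apply: nearW => z; rewrite big_nil.
case Pi: (P i); last first.
  by apply: smooth_near_eq IH; apply: nearW => z; rewrite big_cons Pi.
apply: smooth_near_eq (smooth_nearD (sf i Pi) IH).
by apply: nearW => z; rewrite big_cons Pi.
Qed.

Lemma smooth_near_prod E (x : E) I (r : seq I) (P : pred I) (f : I -> E -> R) :
  (forall i, P i -> smooth_near x (f i)) ->
  smooth_near x (fun z => \prod_(i <- r | P i) f i z).
Proof.
move=> sf; elim: r => [|i r IH].
  apply: smooth_near_eq (@smooth_near_cst E R x 1).
  by apply: nearW => z; rewrite big_nil.
case Pi: (P i); last first.
  by apply: smooth_near_eq IH; apply: nearW => z; rewrite big_cons Pi.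
apply: smooth_near_eq (smooth_nearM (sf i Pi) IH).
by apply: nearW => z; rewrite big_cons Pi.
Qed.

Lemma smooth_near_det E (x : E) m (A : E -> 'M[R]_m) :
  (forall i j, smooth_near x (fun z => A z i j)) -> smooth_near x (fun z => \det (A z)).
Proof.
move=> sA; rewrite /determinant; apply: smooth_near_sum => s _.
apply: (@smooth_nearM _ _ (fun=> _)); first exact: smooth_near_cst.
by apply: smooth_near_prod.
Qed.

(** Cramer's rule expresses the entries by cofactors over the determinant. [invmx] returns a
    singular matrix unchanged, so the formula is used only near [x], where the determinant stays
    nonzero. *)
Lemma smooth_near_invmx E (x : E) m (A : E -> 'M[R]_m) : A x \in unitmx ->
  (forall i j, smooth_near x (fun z => A z i j)) ->
  forall i j, smooth_near x (fun z => invmx (A z) i j).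
Proof.
move=> uA sA i j; have sd := smooth_near_det sA.
have d0 : \det (A x) != 0 by rewrite -unitfE -unitmxE.
have sc : smooth_near x (fun z => cofactor (A z) j i).
  apply: (@smooth_nearM _ _ (fun=> _)); first exact: smooth_near_cst.
  apply: smooth_near_det => a b.
  by apply: smooth_near_eq (sA (lift j a) (lift i b)); apply: nearW => z; rewrite !mxE.
have sp := smooth_nearM (smooth_nearV (f := fun z => \det (A z)) d0 sd) sc.
apply: smooth_near_eq sp; have : \forall z \near x, \det (A z) != 0.
  exact: cvgr_neq0 (differentiable_continuous (smooth_near_differentiable sd)) d0.
by apply: filterS => z dz; rewrite /invmx unitmxE unitfE dz !mxE.
Qed.

Lemma smooth_nearZ E F (x : E) (f : E -> R) (a : F) :
  smooth_near x f -> smooth_near x (fun z => f z *: a).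
Proof.
have lL : linear (fun r : R => r *: a) by move=> r s t; rewrite scalerDl -scalerA.
pose L : {linear R -> F} := HB.pack (fun r : R => r *: a) (GRing.isLinear.Build _ _ _ _ _ lL).
apply: (smooth_near_comp_linear (L := L)).
exact: scalel_continuous.
Qed.

Lemma smooth_near_crd E F (B : coordinates F) (x : E) (f : E -> F) :
  (forall i, smooth_near x (fun z => crd B i (f z))) -> smooth_near x f.
Proof.
move=> sf; apply: (@smooth_near_eq _ _ _ (fun z => \sum_i crd B i (f z) *: cvec B i)).
  by apply: nearW => z; rewrite -crdE.
by apply: smooth_near_sum => i _; exact: smooth_nearZ.
Qed.

(** [Ck] speaks only of derivatives in fixed directions. Expanding [v z] over the vectors [cvec B j]
    turns the value into a sum of such derivatives, weighted by the smooth coordinates of [v]. *)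
Lemma smooth_near_diff E F (B : coordinates E) (C : coordinates F) (x : E)
    (f : E -> F) (v : E -> E) : smooth_near x f ->
  smooth_near x v -> smooth_near x (fun z => 'd f z (v z)).
Proof.
move=> sf sv; apply: (smooth_near_crd (B := C)) => i.
have sB j : smooth_near x (fun z => crd B j (v z)).
  by apply: smooth_near_comp_linear sv; exact: crd_continuous.
have sC j : smooth_near x (fun z => crd C i ('D_(cvec B j) f z)).
  by apply: smooth_near_comp_linear; [exact: crd_continuous|exact: smooth_near_derive].
apply: (@smooth_near_eq _ _ _
  (fun z => \sum_j crd B j (v z) * crd C i ('D_(cvec B j) f z))); last first.
  by apply: smooth_near_sum => j _; exact: smooth_nearM.
near=> z; have dfz : differentiable f z.
  by apply: smooth_near_differentiable; near: z; exact: smooth_near_near.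
rewrite [in RHS](crdE B (v z)) !linear_sum; apply: eq_bigr => j _ /=.
by rewrite !linearZ /= deriveE.
Unshelve. all: by end_near. Qed.

End SmoothNear.

(** * Coordinates on row vectors, scalars and products *)

Section Coordinates.
Context {R : realType}.

Lemma linear_fst (E F : normedModType R) : linear (@fst E F). Proof. by []. Qed.
Lemma linear_snd (E F : normedModType R) : linear (@snd E F). Proof. by []. Qed.
Lemma linear_coord n (i : 'I_n) : linear (fun v : 'rV[R]_n => v 0 i).
Proof. by move=> a u v; rewrite !mxE. Qed.

HB.instance Definition _ (E F : normedModType R) :=
  GRing.isLinear.Build _ _ _ _ _ (@linear_fst E F).
HB.instance Definition _ (E F : normedModType R) :=
  GRing.isLinear.Build _ _ _ _ _ (@linear_snd E F).

Definition rV_coord n (i : 'I_n) : {linear 'rV[R]_n -> R} :=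
  HB.pack (fun v : 'rV[R]_n => v 0 i) (GRing.isLinear.Build _ _ _ _ _ (@linear_coord n i)).

Lemma continuous_fst (E F : normedModType R) : continuous (@fst E F).
Proof. by move=> z; exact: cvg_fst. Qed.
Lemma continuous_snd (E F : normedModType R) : continuous (@snd E F).
Proof. by move=> z; exact: cvg_snd. Qed.

Lemma near_fst (E F : normedModType R) (z : E * F) (P : E -> Prop) :
  (\forall x \near z.1, P x) -> \forall y \near z, P y.1.
Proof. exact: (@continuous_fst E F z P). Qed.

Definition rV_coordinates n : coordinates 'rV[R]_n.
Proof.
refine (@Coordinates R 'rV[R]_n 'I_n (fun i => delta_mx 0 i) (@rV_coord n) _ _).
  by move=> i; exact: coord_continuous.
exact: row_sum_delta.
Defined.

Definition real_coordinates : coordinates R.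
Proof.
refine (@Coordinates R R unit (fun=> 1) (fun=> idfun) _ _).
  by move=> _ x; exact: cvg_id.
by move=> v; rewrite big_const card_unit /= addr0; exact/esym/mulr1.
Defined.

Definition pair_coordinates (E F : normedModType R) (B : coordinates E)
  (C : coordinates F) : coordinates (E * F)%type.
Proof.
refine (@Coordinates R (E * F)%type (cidx B + cidx C)%type
 (fun k => match k with inl i => (cvec B i, 0) | inr j => (0, cvec C j) end)
 (fun k => match k with inl i => (crd B i \o fst)
                      | inr j => crd C j \o snd end) _ _).
  move=> [i|j] z.
    by apply: continuous_comp; [exact: continuous_fst|exact: crd_continuous].
  by apply: continuous_comp; [exact: continuous_snd|exact: crd_continuous].
move=> v; rewrite big_sumType /=.
apply: injective_projections; rewrite /= !linear_sum /=.
  by rewrite [X in _ + X]big1 ?addr0 => [|j _]; [exact: crdE|exact: scaler0].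
by rewrite [X in X + _]big1 ?add0r => [|j _]; [exact: crdE|exact: scaler0].
Defined.

End Coordinates.
Arguments real_coordinates R : clear implicits.

(** * Charts *)

(* What charts provide when [P] has no topology, as for [tangent M]. *)
Record good_charts (R : realType) (E : normedModType R) (P : Type) (A : charts E P) : Prop :=
  GoodCharts {
    dom_chart_at : forall p, dom (chart_at A p) p;
    coordK : forall (i : chart A) p, dom i p -> param i (coord i p) = p;
    paramK_near : forall (i j : chart A) p, dom i p -> dom j p ->
      \forall z \near coord i p,
        [/\ dom i (param i z), dom j (param i z) & coord i (param i z) = z];
    transition_smooth : forall (i j : chart A) p, dom i p -> dom j p ->
      smooth_near (coord i p) (transition i j) }.

Section TangentMaps.
Context {R : realType} {E : normedModType R} {P : Type} (A : charts E P).

Fact tcomp_is_linear (i : chart A) u : linear (tcomp i u).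
Proof. by move=> a v w; rewrite /tcomp linearP. Qed.
HB.instance Definition _ (i : chart A) u :=
  GRing.isLinear.Build _ _ _ _ (tcomp i u) (@tcomp_is_linear i u).

Fact tvec_is_linear (i : chart A) u : linear (tvec i u).
Proof. by move=> a v w; rewrite /tvec linearP. Qed.
HB.instance Definition _ (i : chart A) u :=
  GRing.isLinear.Build _ _ _ _ (tvec i u) (@tvec_is_linear i u).

Fact dirder_is_linear u f : linear (fun v => dirder A u v f).
Proof. by move=> a v w; rewrite /dirder linearP. Qed.

End TangentMaps.

(** * Change of chart, derivatives of functions and smooth fields *)

Section GoodCharts.
Context {R : realType} {E : normedModType R} {P : Type} {A : charts E P}.
Hypothesis gA : good_charts A.
Implicit Types (i j k c : chart A) (u p : P).

Lemma transition_differentiable i j p : dom i p -> dom j p ->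
  differentiable (transition i j) (coord i p).
Proof. by move=> ip jp; apply/smooth_near_differentiable/transition_smooth. Qed.

Lemma transition_coord i j p : dom i p -> transition i j (coord i p) = coord j p.
Proof. by move=> ip; rewrite /transition /= coordK. Qed.

(** Chain rule: near [coord i p], reading [f] in the chart [i] is reading it in the chart [j] after
    the transition. All rules for changing charts come from this one. *)
Lemma diff_transition_comp (F : normedModType R) (f : P -> F) i j p w :
  dom i p -> dom j p -> differentiable (f \o param j) (coord j p) ->
  differentiable (f \o param i) (coord i p) /\
  'd (f \o param j) (coord j p) ('d (transition i j) (coord i p) w) =
  'd (f \o param i) (coord i p) w.
Proof.
move=> ip jp df; have dt := transition_differentiable ip jp.
have E1 : \forall z \near coord i p,
    ((f \o param j) \o transition i j) z = (f \o param i) z.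
  by have := paramK_near gA ip jp; apply: filterS => z [_ jz _]; rewrite /= coordK.
have dc : differentiable ((f \o param j) \o transition i j) (coord i p).
  by apply: differentiable_comp => //; rewrite transition_coord.
have [d1 d2] := near_eq_diff E1 dc; split=> //.
rewrite d2 diff_comp //=; last by rewrite transition_coord.
by rewrite transition_coord.
Qed.

(** The preceding lemma with [coord k] for [f]: the cocycle rule for Jacobians. *)
Lemma diff_transition_trans i j k p w : dom i p -> dom j p -> dom k p ->
  'd (transition j k) (coord j p) ('d (transition i j) (coord i p) w) =
  'd (transition i k) (coord i p) w.
Proof.
move=> ip jp kp.
by case: (diff_transition_comp w ip jp (transition_differentiable jp kp)).
Qed.

Lemma diff_transition_id i p w : dom i p -> 'd (transition i i) (coord i p) w = w.
Proof.
move=> ip; have E1 : \forall z \near coord i p, id z = transition i i z.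
  by have := paramK_near gA ip ip; apply: filterS => z [_ _ zE]; rewrite /transition /= zE.
have [_ ->] := near_eq_diff E1 (@ex_diff _ _ _ _ _ _ _ (is_diff_id (coord i p))).
by rewrite diff_val.
Qed.

Lemma tcomp_tvec i u w : dom i u -> tcomp i u (tvec i u w) = w.
Proof.
move=> iu; have cu := dom_chart_at gA u.
by rewrite /tcomp /tvec diff_transition_trans // diff_transition_id.
Qed.

Lemma tvec_tcomp i u v : dom i u -> tvec i u (tcomp i u v) = v.
Proof.
move=> iu; have cu := dom_chart_at gA u.
by rewrite /tcomp /tvec diff_transition_trans // diff_transition_id.
Qed.

Lemma tcomp_change i j u v : dom i u -> dom j u ->
  tcomp j u v = 'd (transition i j) (coord i u) (tcomp i u v).
Proof.
by move=> iu ju; have cu := dom_chart_at gA u; rewrite /tcomp diff_transition_trans.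
Qed.

Lemma tcomp_tvec_change i j u w : dom i u -> dom j u ->
  tcomp j u (tvec i u w) = 'd (transition i j) (coord i u) w.
Proof. by move=> iu ju; rewrite (tcomp_change _ iu ju) tcomp_tvec. Qed.

(** [dirder] is defined in a chart that depends on the point. Here one chart serves a whole
    neighbourhood, as needed to differentiate the result again. *)
Lemma dirder_change i u v (f : P -> R) : dom i u ->
  differentiable (f \o param i) (coord i u) ->
  dirder A u v f = 'd (f \o param i : E -> R) (coord i u) (tcomp i u v).
Proof.
move=> iu df; have cu := dom_chart_at gA u.
by have [_ dE] := diff_transition_comp v cu iu df; exact/esym.
Qed.

Lemma near_point_dom i u : dom i u -> near_point A u (dom i).
Proof.
move=> iu; have := paramK_near gA (dom_chart_at gA u) iu.
by rewrite /near_point; apply: filterS => z [].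
Qed.

Lemma near_pointS u (Q Q' : P -> Prop) : (forall w, Q w -> Q' w) ->
  near_point A u Q -> near_point A u Q'.
Proof. by move=> QQ'; apply: filterS => z; exact: QQ'. Qed.

Lemma near_pointI u (Q Q' : P -> Prop) :
  near_point A u Q -> near_point A u Q' -> near_point A u (fun w => Q w /\ Q' w).
Proof. exact: filterI. Qed.

Lemma smooth_at_eq u (f g : P -> R) : near_point A u (fun w => f w = g w) ->
  smooth_at A u f -> smooth_at A u g.
Proof. exact: smooth_near_eq. Qed.

Lemma smooth_at_cst u (a : R) : smooth_at A u (fun=> a).
Proof. exact: smooth_near_cst. Qed.

Lemma smooth_atD u (f g : P -> R) :
  smooth_at A u f -> smooth_at A u g -> smooth_at A u (fun w => f w + g w).
Proof. exact: smooth_nearD. Qed.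

Lemma smooth_atM u (f g : P -> R) :
  smooth_at A u f -> smooth_at A u g -> smooth_at A u (fun w => f w * g w).
Proof. exact: smooth_nearM. Qed.

Lemma smooth_at_sum u I (r : seq I) (Q : pred I) (f : I -> P -> R) :
  (forall m, Q m -> smooth_at A u (f m)) ->
  smooth_at A u (fun w => \sum_(m <- r | Q m) f m w).
Proof. exact: smooth_near_sum. Qed.

Lemma smooth_at_invmx u m (B : P -> 'M[R]_m) : B u \in unitmx ->
  (forall a b, smooth_at A u (fun w => B w a b)) ->
  forall a b, smooth_at A u (fun w => invmx (B w) a b).
Proof.
move=> uB; apply: (smooth_near_invmx (A := B \o param (chart_at A u))).
by rewrite /here /= coordK //; exact: (dom_chart_at gA).
Qed.

Lemma dirder_eq u v (f g : P -> R) : near_point A u (fun w => f w = g w) ->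
  smooth_at A u f -> dirder A u v g = dirder A u v f.
Proof.
by move=> fg /smooth_near_differentiable df; rewrite /dirder; case: (near_eq_diff fg df) => _ ->.
Qed.

Lemma dirder_cst u v (a : R) : dirder A u v (fun=> a) = 0.
Proof. by rewrite /dirder -[_ \o _]/(cst a) diff_cst. Qed.

Lemma dirderD u v (f g : P -> R) : smooth_at A u f -> smooth_at A u g ->
  dirder A u v (fun w => f w + g w) = dirder A u v f + dirder A u v g.
Proof.
move=> /smooth_near_differentiable df /smooth_near_differentiable dg.
exact: (congr1 (fun h : E -> R => h v) (diffD df dg)).
Qed.

Lemma dirderM u v (f g : P -> R) : smooth_at A u f -> smooth_at A u g ->
  dirder A u v (fun w => f w * g w) = f u * dirder A u v g + dirder A u v f * g u.
Proof.
move=> /smooth_near_differentiable df /smooth_near_differentiable dg.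
apply: etrans (congr1 (fun h : E -> R => h v) (diffM df dg)) _.
rewrite /= /here (coordK gA); last exact: (dom_chart_at gA).
exact: (congr1 (fun y => f u * dirder A u v g + y) (mulrC (g u) (dirder A u v f))).
Qed.

Lemma dirder_sum u v I (r : seq I) (Q : pred I) (f : I -> P -> R) :
  (forall m, Q m -> smooth_at A u (f m)) ->
  dirder A u v (fun w => \sum_(m <- r | Q m) f m w) =
  \sum_(m <- r | Q m) dirder A u v (f m).
Proof.
move=> sf; elim: r => [|i r IH].
  rewrite big_nil -[RHS](dirder_cst u v 0).
  by congr dirder; apply/funext => w; rewrite big_nil.
rewrite big_cons -IH; case Qi: (Q i).
  rewrite -dirderD; [|exact: sf|exact: smooth_at_sum].
  by congr dirder; apply/funext => w; rewrite big_cons Qi.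
by congr dirder; apply/funext => w; rewrite big_cons Qi.
Qed.

Variable B : coordinates E.

(** Near [u], the components in [i] are obtained from those in [chart_at A u] by the differential of
    a smooth transition applied to a smooth map, the situation of [smooth_near_diff]. *)
Lemma smooth_at_tcomp i u (Y : P -> E) (L : {linear E -> R}) :
  continuous L -> dom i u -> smooth_field_at A u Y ->
  smooth_at A u (fun w => L (tcomp i w (Y w))).
Proof.
move=> cL iu sY; have cu := dom_chart_at gA u.
apply: (@smooth_near_comp_linear _ _ _ _ _ L
  (fun z => tcomp i (param (chart_at A u) z) (Y (param (chart_at A u) z))) cL).
apply: smooth_near_eq (smooth_near_diff B B (transition_smooth gA cu iu) sY).
have := paramK_near gA cu iu; apply: filterS => z [cz iz zE].
by rewrite [RHS](tcomp_change _ cz iz) zE.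
Qed.

Lemma smooth_field_at_crd u (Y : P -> E) :
  (forall a, smooth_at A u (fun w => crd B a (tcomp (chart_at A u) w (Y w)))) ->
  smooth_field_at A u Y.
Proof. by move=> sY; apply: (smooth_near_crd (B := B)) => k; exact: sY. Qed.

Lemma smooth_field_crd i u (Y : P -> E) b : dom i u -> smooth_field_at A u Y ->
  smooth_at A u (fun w => crd B b (tcomp i w (Y w))).
Proof. by move=> iu; apply: (smooth_at_tcomp (@crd_continuous _ _ B b)). Qed.

Lemma smooth_field_eq u (Y Z : P -> E) : near_point A u (fun w => Y w = Z w) ->
  smooth_field_at A u Y -> smooth_field_at A u Z.
Proof.
move=> YZ; apply: smooth_near_eq; move: YZ; rewrite /near_point.
by apply: filterS => z /= ->.
Qed.

Lemma smooth_fieldZ u (f : P -> R) (Y : P -> E) : smooth_at A u f ->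
  smooth_field_at A u Y -> smooth_field_at A u (fun w => f w *: Y w).
Proof.
move=> sf sY; apply: smooth_field_at_crd => b.
apply: smooth_at_eq (smooth_atM sf (smooth_field_crd b (dom_chart_at gA u) sY)).
by apply: nearW => z /=; rewrite !linearZ.
Qed.

Lemma smooth_field_sum u I (r : seq I) (Q : pred I) (Y : I -> P -> E) :
  (forall m, Q m -> smooth_field_at A u (Y m)) ->
  smooth_field_at A u (fun w => \sum_(m <- r | Q m) Y m w).
Proof.
move=> sY; apply: smooth_field_at_crd => b.
apply: (@smooth_at_eq _ (fun w => \sum_(m <- r | Q m)
   crd B b (tcomp (chart_at A u) w (Y m w)))).
  by apply: nearW => z /=; rewrite !linear_sum.
by apply: smooth_at_sum => m Qm; apply: smooth_field_crd (sY m Qm); exact: (dom_chart_at gA).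
Qed.

Lemma smooth_at_dirder u (X : P -> E) (f : P -> R) :
  smooth_field_at A u X -> smooth_at A u f ->
  smooth_at A u (fun w => dirder A w (X w) f).
Proof.
move=> sX sf; have cu := dom_chart_at gA u.
apply: smooth_near_eq (smooth_near_diff B (real_coordinates R) sf sX).
have [E1 E2] := (paramK_near gA cu cu, smooth_near_near sf).
near=> z; have [cz _ zE] : [/\ dom (chart_at A u) (param (chart_at A u) z),
    dom (chart_at A u) (param (chart_at A u) z) &
    coord (chart_at A u) (param (chart_at A u) z) = z] by near: z.
rewrite /= [RHS](dirder_change _ cz) zE //.
by apply: smooth_near_differentiable; near: z.
Unshelve. all: by end_near. Qed.

(** * Linear connections and finite sums *)

Section Connection.
Variables (W : set P) (D : P -> E -> (P -> E) -> E).
Hypothesis lD : linear_connection A W D.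

Lemma connection_dir_sum u Y I (r : seq I) (x : I -> R) (V : I -> E) :
  W u -> smooth_field_at A u Y ->
  D u (\sum_(m <- r) x m *: V m) Y = \sum_(m <- r) x m *: D u (V m) Y.
Proof.
case: lD => Dv _ _ _ _ Wu sY.
have D0 : D u 0 Y = 0.
  have /eqP := Dv u 1 0 0 Y Wu sY.
  by rewrite scaler0 addr0 scale1r -subr_eq subrr eq_sym => /eqP.
by elim: r => [|m r IH]; rewrite ?big_nil // !big_cons Dv // IH.
Qed.

Lemma connection_sumZ u v I (r : seq I) (f : I -> P -> R) (Y : I -> P -> E) :
  W u -> (forall m, smooth_at A u (f m)) -> (forall m, smooth_field_at A u (Y m)) ->
  D u v (fun w => \sum_(m <- r) f m w *: Y m w) =
  \sum_(m <- r) (dirder A u v (f m) *: Y m u + f m u *: D u v (Y m)).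
Proof.
case: lD => _ DD DL _ _ Wu sf sY.
have s0 : smooth_field_at A u (fun=> 0 : E).
  apply: smooth_near_eq (smooth_near_cst _ 0).
  by apply: nearW => z /=; rewrite linear0.
elim: r => [|m r IH].
  (* The zero field is written as the zero function times the zero field, so that the Leibniz rule
     computes its derivative. *)
  rewrite big_nil [X in D u v X](_ : _ = fun w => 0 *: 0); last first.
    by apply/funext => w; rewrite big_nil scaler0.
  rewrite (DL _ _ (fun=> 0)) //; last exact: smooth_at_cst.
  by rewrite dirder_cst !scale0r addr0.
rewrite [X in D u v X](_ : _ =
    fun w => f m w *: Y m w + \sum_(m <- r) f m w *: Y m w); last first.
  by apply/funext => w; rewrite big_cons.
rewrite DD ?DL ?IH ?big_cons //; first exact: smooth_fieldZ.
by apply: smooth_field_sum => k _; exact: smooth_fieldZ.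
Qed.

End Connection.

End GoodCharts.

(** * Charts of the manifold and of its tangent bundle *)

Section GoodTangentCharts.
Context {R : realType} {n : nat} (M : manifold R n).

(** Continuity of [param i] pulls the open set [dom j] back to a neighbourhood of [coord i p]; this
    turns the topology of the manifold into statements about nearby coordinates. *)
Lemma manifold_good_charts : good_charts (atlas M).
Proof.
have [oD cat cK pC ts] := manifold_smooth M.
have imgE (i : chart (atlas M)) z : (coord i @` dom i) z ->
    dom i (param i z) /\ coord i (param i z) = z.
  by move=> [p ip <-]; have [-> _] := cK i p ip.
have nearE (i j : chart (atlas M)) p : dom i p -> dom j p ->
    \forall z \near coord i p,
      [/\ dom i (param i z), dom j (param i z) & coord i (param i z) = z].
  move=> ip jp; have iz : (coord i @` dom i) (coord i p) by exists p.
  have Ni : \forall z \near coord i p, (coord i @` dom i) z.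
    by apply: open_near iz _ => //; case: (oD i).
  have Nj : \forall z \near coord i p, dom j (param i z).
    apply: (pC i _ iz); have [-> _] := cK i p ip.
    by apply: open_nbhs_nbhs; split=> //; case: (oD j).
  by apply: filterS2 Ni Nj => z /imgE[? ?] ?.
split=> // [i p ip|i j p ip jp]; first by case: (cK i p ip).
have := nearE i j p ip jp; rewrite -nbhs_nearE nbhsE => -[U [oU Uz] UE].
exists U; split=> // k; apply: Ck_subset (ts i j k) => z /UE[iz jz zE].
by exists (param i z).
Qed.

Let gM := manifold_good_charts.

(** The classical form of induced coordinate changes, x' = t(x) and y' = dt_x(y). It holds near the
    point, where [param] really inverts [coord]. *)
Lemma tangent_transition_near (i j : chart (atlas M)) (u : tangent M) :
  dom i (base u) -> dom j (base u) ->
  \forall z \near (coord (i : chart (tangent_charts M)) u),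
   transition (A := tangent_charts M) i j z =
   (transition (A := atlas M) i j z.1, 'd (transition (A := atlas M) i j) (z.1) z.2).
Proof.
move=> iu ju; have := paramK_near gM iu ju => N1.
have := near_fst (z := coord (i : chart (tangent_charts M)) u) N1.
apply: filterS => z [iz jz zE].
by rewrite /transition /= (tcomp_tvec_change gM _ iz jz) zE.
Qed.

Lemma tangent_good_charts : good_charts (tangent_charts M).
Proof.
split.
- by move=> u; exact: (dom_chart_at gM).
- move=> i [p y] /= ip; by rewrite (coordK gM) // (tvec_tcomp gM).
- move=> i j u iu ju; have N1 := paramK_near gM iu ju.
  have := near_fst (z := coord (i : chart (tangent_charts M)) u) N1.
  apply: filterS => z [iz jz zE]; split=> //=.
  by rewrite zE (tcomp_tvec gM) // -surjective_pairing.
- move=> i j u iu ju; have N := tangent_transition_near iu ju.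
  apply: (@smooth_near_eq _ _ _ _
    (fun z => (transition (A := atlas M) i j z.1, 'd (transition (A := atlas M) i j) (z.1) z.2))).
    by apply: filterS N => z ->.
  have st := transition_smooth gM iu ju.
  have s1 : smooth_near (coord (i : chart (tangent_charts M)) u)
      (transition (A := atlas M) i j \o fst).
    by apply: smooth_near_linear_comp => //; exact: continuous_fst.
  apply: (smooth_near_crd (B := pair_coordinates (rV_coordinates n) (rV_coordinates n))).
  have cc a : continuous (@rV_coord R n a) by exact: coord_continuous.
  case=> a; first exact: (smooth_near_comp_linear (cc a) s1).
  (* The fibre part dt_x(y) is seen as the differential of [transition i j \o fst] at [z] along
     [(z.2, 0)], the form that [smooth_near_diff] handles. *)
  pose v (z : 'rV[R]_n * 'rV[R]_n) := (z.2, 0 : 'rV[R]_n).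
  have sv : smooth_near (coord (i : chart (tangent_charts M)) u) v.
    apply: (smooth_near_crd (B := pair_coordinates (rV_coordinates n) (rV_coordinates n))).
    case=> b.
      exact: (smooth_near_comp_linear (cc b) (smooth_near_linear _ (@continuous_snd _ _ _))).
    rewrite [X in smooth_near _ X](_ : _ = fun=> 0); first exact: smooth_near_cst.
    by apply/funext => z /=; rewrite mxE.
  apply: (@smooth_near_comp_linear _ _ _ _ _ (@rV_coord R n a)
    (fun z => 'd (transition (A := atlas M) i j) (z.1) z.2) (cc a)).
  apply: smooth_near_eq (smooth_near_diff
    (pair_coordinates (rV_coordinates n) (rV_coordinates n)) (rV_coordinates n) s1 sv).
  have := near_fst (z := coord (i : chart (tangent_charts M)) u) (smooth_near_near st).
  apply: filterS => z /smooth_near_differentiable dz.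
  have cf := continuous_fst (E := 'rV[R]_n) (F := 'rV[R]_n).
  by rewrite diff_comp ?diff_lin //; exact: linear_differentiable.
Qed.

End GoodTangentCharts.

(** * The tangent bundle *)

Section Slit.
Context {R : realType} {n : nat} (M : manifold R n).

(** In the slit case: [tcomp] and [tvec] are inverse linear maps on fibres, so a fibre vector is
    nonzero exactly when its coordinates are, and this is an open condition. *)
Lemma near_slit (W : set (tangent M)) u : W = setT \/ W = slit M -> W u ->
  near_point (tangent_charts M) u W.
Proof.
case=> -> => [_|u0]; first exact: filterT.
have gM := manifold_good_charts M; have cu := dom_chart_at gM (base u).
have N1 : \forall z \near here (tangent_charts M) u,
    dom (chart_at (atlas M) (base u)) (param (chart_at (atlas M) (base u)) z.1).
  have := near_fst (z := here (tangent_charts M) u) (paramK_near gM cu cu).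
  by apply: filterS => z [].
have N2 : \forall z \near here (tangent_charts M) u, z.2 != 0.
  have v0 : (here (tangent_charts M) u).2 != 0.
    apply: contra u0 => /eqP /= u0; apply/eqP.
    by rewrite -(tvec_tcomp gM (fibre u) cu) u0 linear0.
  have cs := @continuous_snd R 'rV[R]_n 'rV[R]_n (here (tangent_charts M) u).
  exact: (cvgr_neq0 _ cs v0).
apply: filterS2 N1 N2 => z iz; apply: contra => /eqP /= z0; apply/eqP.
by rewrite -(tcomp_tvec gM z.2 iz) z0 linear0.
Qed.

End Slit.

(** Along [(0, w)] the map is affine, so its difference quotient is constant. *)
Lemma diff_fibre_linear (R : realType) (E F G : normedModType R)
    (L : E -> {linear F -> G}) (z : E * F) (w : F) :
  differentiable (fun y : E * F => L y.1 y.2) z ->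
  'd (fun y : E * F => L y.1 y.2) z (0, w) = L z.1 w.
Proof.
move=> dL; rewrite -deriveE //; apply: lim_near_cst => //.
near=> h; have h0 : h != 0 by near: h; exact: nbhs_dnbhs_neq.
by rewrite /= scaler0 add0r linearP addrK scalerA mulVf // scale1r.
Unshelve. all: by end_near. Qed.

(** * Jacobian of the induced coordinate changes *)

Section TangentTransition.
Context {R : realType} {n : nat} (M : manifold R n).
Let gM := manifold_good_charts M.
Let gA := tangent_good_charts M.
Implicit Types (i j : chart (tangent_charts M)) (u : tangent M).

Definition base_jac i j u : {linear 'rV[R]_n -> 'rV[R]_n} :=
  'd (transition (A := atlas M) i j) (coord (i : chart (atlas M)) (base u)).

Lemma tcomp_base i j u v : dom i u -> dom j u ->
  (tcomp j u v).1 = base_jac i j u (tcomp i u v).1.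
Proof.
move=> iu ju; rewrite (tcomp_change gA v iu ju).
set w := tcomp i u v; have dT := transition_differentiable gA iu ju.
have dt := transition_differentiable gM iu ju.
have cf := @continuous_fst R 'rV[R]_n 'rV[R]_n.
have N1 : \forall z \near coord i u,
    (fst \o transition i j) z = (transition (A := atlas M) i j \o fst) z.
  by have := tangent_transition_near iu ju; apply: filterS => z /(congr1 fst).
have [_ dE] := near_eq_diff N1 (differentiable_linear_comp cf dT).
rewrite -(diff_linear_comp w cf dT) -dE.
exact: (diff_comp_linear (x := coord i u) w cf dt).
Qed.

Lemma tcomp_fibre i j u v : dom i u -> dom j u -> (tcomp i u v).1 = 0 ->
  (tcomp j u v).2 = base_jac i j u (tcomp i u v).2.
Proof.
move=> iu ju; rewrite (tcomp_change gA v iu ju).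
move: (tcomp i u v) => [w1 w2] /= ->; have dT := transition_differentiable gA iu ju.
have cs := @continuous_snd R 'rV[R]_n 'rV[R]_n.
have N1 : \forall z \near coord i u, (snd \o transition i j) z =
    'd (transition (A := atlas M) i j) (z.1) z.2.
  by have := tangent_transition_near iu ju; apply: filterS => z /(congr1 snd).
have [dg dE] := near_eq_diff N1 (differentiable_linear_comp cs dT).
apply: etrans (esym (diff_linear_comp (0, w2) cs dT)) _.
apply: etrans (esym (congr1 (fun f => f (0, w2)) dE)) _.
exact: (diff_fibre_linear (L := fun x => 'd (transition (A := atlas M) i j) x) w2 dg).
Qed.

(** Both clauses share one [J]. Second derivatives of the base transition act on fibre components
    only through the base component, hence the restriction to vertical vectors in the second
    clause. *)
Lemma tcomp_jacobian i j u : dom i u -> dom j u ->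
  exists J : {linear 'rV[R]_n -> 'rV[R]_n},
    (forall v, (tcomp j u v).1 = J (tcomp i u v).1) /\
    (forall v, (tcomp i u v).1 = 0 -> (tcomp j u v).2 = J (tcomp i u v).2).
Proof.
move=> iu ju; exists (base_jac i j u).
by split=> v; [exact: tcomp_base|exact: tcomp_fibre].
Qed.

End TangentTransition.

(** * Adapted frames *)

Section Frames.
Context {R : realType} {n : nat} {M : manifold R n}.
Local Notation TM := (tangent M).
Local Notation A := (tangent_charts M).
Local Notation TTM := ('rV[R]_n * 'rV[R]_n)%type.
Variable N : chart A -> 'I_n -> 'I_n -> TM -> R.
Let gA := tangent_good_charts M.
Let B := pair_coordinates (rV_coordinates (R := R) n) (rV_coordinates n).
Implicit Types (b d : bool) (i j k : chart A) (u w : TM) (v : TTM) (Y : TM -> TTM).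

(* Below [true] stands for horizontal and [false] for vertical. *)
Definition component b k u v (a : 'I_n) : R :=
  if b then hcomp k u v a else vcomp N k u v a.

Definition adapted_frame b k (a : 'I_n) u : TTM := if b then delta N k a u else vdot k a u.

Definition projection b u v : TTM :=
  let c := chart_at A u in \sum_a component b c u v a *: adapted_frame b c a u.

Fact comp_is_linear b k u a : linear (fun v => component b k u v a : R).
Proof.
move=> s v w; case: b; rewrite /component /hcomp /vcomp linearP /= !mxE //.
rewrite scalerDr scaler_sumr addrACA; congr (_ + _).
by rewrite -big_split; apply: eq_bigr => mu _ /=; rewrite !mxE mulrDr mulrCA.
Qed.

Definition comp_linear b k u a : {linear TTM -> R} :=
  HB.pack (fun v => component b k u v a : R)
    (GRing.isLinear.Build _ _ _ _ _ (@comp_is_linear b k u a)).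

Lemma compD b k u v v' a : component b k u (v + v') a = component b k u v a + component b k u v' a.
Proof. exact: (linearD (comp_linear b k u a)). Qed.

Lemma compZ b k u s v a : component b k u (s *: v) a = s * component b k u v a.
Proof. exact: (linearZZ (comp_linear b k u a) s v). Qed.

Lemma comp0 b k u a : component b k u 0 a = 0.
Proof. exact: (linear0 (comp_linear b k u a)). Qed.

Lemma comp_sum b k u I (r : seq I) (Q : pred I) (V : I -> TTM) a :
  component b k u (\sum_(m <- r | Q m) V m) a = \sum_(m <- r | Q m) component b k u (V m) a.
Proof. exact: (linear_sum (comp_linear b k u a)). Qed.

Lemma tcomp_delta k u mu : dom k u ->
  tcomp k u (delta N k mu u) = (delta_mx 0 mu, - \row_a N k a mu u).
Proof. exact: (tcomp_tvec gA). Qed.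

Lemma tcomp_vdot k u a : dom k u -> tcomp k u (vdot k a u) = (0, delta_mx 0 a).
Proof. exact: (tcomp_tvec gA). Qed.

Lemma comp_frame b d k u a m : dom k u ->
  component b k u (adapted_frame d k a u) m = ((b == d) && (m == a))%:R.
Proof.
move=> ku; rewrite /component /adapted_frame /hcomp /vcomp.
case: b; case: d; rewrite ?tcomp_delta ?tcomp_vdot //= !mxE ?eqxx //=.
  (* Vertical component of [delta]: the [- N] in its fibre coordinates cancels the correction made
     by [vcomp]. *)
  rewrite (bigD1 a) //= big1 => [|mu ma]; rewrite !mxE ?eqxx ?mulr1 ?addr0 ?addNr //.
  by rewrite (negPf ma) mulr0.
by rewrite big1 ?addr0 // => mu _; rewrite mxE mulr0.
Qed.

Lemma frame_decomposition k u v : dom k u ->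
  v = \sum_b \sum_a component b k u v a *: adapted_frame b k a u.
Proof.
move=> ku; rewrite -[LHS](tvec_tcomp gA v ku) -[RHS](tvec_tcomp gA _ ku).
congr tvec; rewrite big_bool /= linearD !linear_sum /=.
under [X in X + _]eq_bigr do rewrite linearZ /= tcomp_delta //.
under [X in _ + X]eq_bigr do rewrite linearZ /= tcomp_vdot //.
apply: injective_projections; rewrite /= !linear_sum /=.
  rewrite [X in _ + X]big1 => [|a _]; last exact: scaler0.
  by rewrite addr0 [LHS]row_sum_delta.
(* In the fibre coordinates, the [N] terms of the horizontal and vertical sums cancel. *)
apply/rowP => a; rewrite !mxE !summxE.
rewrite [X in _ + X](bigD1 a) //= [X in _ + (_ + X)]big1 ?addr0 => [|m ma]; last first.
  by rewrite !mxE eqxx eq_sym (negPf ma) mulr0.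
rewrite !mxE !eqxx mulr1 /vcomp addrCA -big_split big1 /= ?addr0 // => m _.
by rewrite !mxE mulrN mulrC addNr.
Qed.

Lemma comp_inj k u v v' : dom k u ->
  (forall b a, component b k u v a = component b k u v' a) -> v = v'.
Proof.
move=> ku E; rewrite (frame_decomposition v ku) (frame_decomposition v' ku).
by apply: eq_bigr => b _; apply: eq_bigr => a _; rewrite E.
Qed.

Lemma comp_sum_frame b d k u (x : 'I_n -> R) m : dom k u ->
  component b k u (\sum_a x a *: adapted_frame d k a u) m = if b == d then x m else 0.
Proof.
move=> ku; rewrite comp_sum (bigD1 m) //= big1 => [|a am]; rewrite compZ comp_frame //.
  by rewrite eqxx andbT addr0; case: eqP; rewrite ?mulr1 ?mulr0.
by rewrite [m == a]eq_sym (negPf am) andbF mulr0.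
Qed.

Definition span b k u : set TTM := if b then hspace N k u else vspace k u.

Lemma spanP b k u v : dom k u -> span b k u v <-> forall a, component (~~ b) k u v a = 0.
Proof.
move=> ku; split=> [|c0].
  by case: b => -[x ->] a; [exact: (comp_sum_frame false true)|exact: (comp_sum_frame true false)].
have -> : v = \sum_a component b k u v a *: adapted_frame b k a u.
  apply: (comp_inj ku) => d a; rewrite comp_sum_frame //.
  by case: eqP => [->//|]; case: b d c0 => -[] // c0 _; exact: c0.
by case: b {c0}; [exists (component true k u v)|exists (component false k u v)].
Qed.

(** * Change of adapted frame under a nonlinear connection *)

Section Nonlinear.
Variable W : set TM.
Hypothesis hN : nonlinear_connection N W.

(** For horizontal spaces this is the transformation law in [nonlinear_connection]. A vector is
    vertical when its base components vanish, and the base Jacobian preserves this. *)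
Lemma span_change b i j u : W u -> dom i u -> dom j u -> span b i u = span b j u.
Proof.
move=> Wu iu ju; case: b; first exact: hN.2.
suff S i' j' : dom i' u -> dom j' u -> span false i' u `<=` span false j' u.
  by rewrite predeqE => v; split; exact: S.
move=> iu' ju' v /(spanP false _ iu') /= h0; apply/(spanP false _ ju') => a /=.
have v0 : (tcomp i' u v).1 = 0 by apply/rowP => m; rewrite [LHS]h0 mxE.
have [J [J1 _]] := tcomp_jacobian iu' ju'.
by rewrite /hcomp J1 v0 linear0 mxE.
Qed.

(** Horizontal components are base coordinates and change by the base Jacobian. For the vertical
    ones, let [p] be the vertical part of [v] taken in [i]: [v - p] is horizontal in every chart, so
    [v] and [p] share their vertical components, and those of the vertical vector [p] change by the
    same Jacobian. *)
Lemma comp_change i j u : W u -> dom i u -> dom j u ->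
  exists J : {linear 'rV[R]_n -> 'rV[R]_n}, forall b v,
    \row_a component b j u v a = J (\row_a component b i u v a).
Proof.
move=> Wu iu ju; have [J [J1 J2]] := tcomp_jacobian iu ju; exists J => -[] v /=.
  have rE k : \row_a component true k u v a = (tcomp k u v).1 by apply/rowP => a; rewrite mxE.
  by apply: etrans (rE j) _; apply: etrans (J1 v) _; exact: (congr1 J (esym (rE i))).
have vertE k v' : (forall a, hcomp k u v' a = 0) ->
    (tcomp k u v').1 = 0 /\ \row_a vcomp N k u v' a = (tcomp k u v').2.
  move=> h0; split; apply/rowP => a; rewrite !mxE; first exact: h0.
  by rewrite /vcomp big1 ?addr0 // => m _; have := h0 m; rewrite /hcomp => ->; rewrite mulr0.
pose p := \sum_a component false i u v a *: adapted_frame false i a u.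
have hp : span true i u (v - p).
  apply/(spanP true _ iu) => a /=; rewrite -[vcomp _ _ _ _ _]/(component false i u (v - p) a).
  by rewrite -scaleN1r compD compZ comp_sum_frame //= mulN1r subrr.
have vp : span false i u p by exists (component false i u v).
have pE k : dom k u -> \row_a vcomp N k u v a = \row_a vcomp N k u p a.
  move=> ku; have := hp; rewrite (span_change true Wu iu ku) => /(spanP true _ ku) h0.
  apply/rowP => a; rewrite !mxE -[v in LHS](subrK p).
  by rewrite [LHS](compD false) h0 add0r.
have [v1 iE] := vertE i p (fun a => (spanP false _ iu).1 vp a).
move: vp; rewrite (span_change false Wu iu ju) => vp.
have [_ jE] := vertE j p (fun a => (spanP false _ ju).1 vp a).
apply: etrans (pE j ju) _; apply: etrans jE _; apply: etrans (J2 p v1) _.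
by congr (J _); exact: etrans (esym iE) (esym (pE i iu)).
Qed.

Lemma sum_part u v : \sum_b projection b u v = v.
Proof. exact/esym/frame_decomposition/(dom_chart_at gA). Qed.

Lemma smooth_comp b k u Y a : W u -> dom k u -> smooth_field_at A u Y ->
  smooth_at A u (fun w => component b k w (Y w) a).
Proof.
move=> Wu ku sY.
have s1 m : smooth_at A u (fun w => (tcomp k w (Y w)).1 0 m).
  apply: (smooth_at_tcomp gA B (L := rV_coord m \o fst)) => //.
  exact: (@crd_continuous _ _ B (inl m)).
case: b; first exact: s1.
apply: (@smooth_atD _ _ _ _ _ (fun w => (tcomp k w (Y w)).2 0 a)).
  apply: (smooth_at_tcomp gA B (L := rV_coord a \o snd)) => //.
  exact: (@crd_continuous _ _ B (inr a)).
apply: smooth_at_sum => m _; apply: smooth_atM => //.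
exact: hN.1.
Qed.

Lemma smooth_frame b u a : W u -> smooth_field_at A u (adapted_frame b (chart_at A u) a).
Proof.
move=> Wu; have cu := dom_chart_at gA u.
apply: (smooth_field_at_crd (B := B)) => x.
have := near_point_dom gA cu.
case: b.
  move=> Nc; apply: (@smooth_at_eq _ _ _ _ _ (fun w => crd B x
    (delta_mx 0 a, - \row_m N (chart_at A u) m a w))).
    by apply: near_pointS Nc => w cw; rewrite /= tcomp_delta.
  case: x => x /=; first exact: smooth_at_cst.
  rewrite [X in smooth_at _ _ X](_ : _ = fun w => - N (chart_at A u) x a w); last first.
    by apply/funext => w; rewrite !mxE.
  by apply: smooth_nearN; exact: hN.1.
move=> Nc; apply: (@smooth_at_eq _ _ _ _ _ (fun w => crd B x
    (0, delta_mx 0 a))); last exact: smooth_at_cst.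
by apply: near_pointS Nc => w cw; rewrite /= tcomp_vdot.
Qed.

Lemma part_def b u v : projection b u v =
  \sum_a component b (chart_at A u) u v a *: adapted_frame b (chart_at A u) a u.
Proof. by []. Qed.

(* Unfolding these makes unification compare the components of a vector in two
   different charts, which does not terminate in practice. *)
Local Opaque component adapted_frame projection.

(** [projection] is defined in [chart_at A u]; since [comp_change] moves each type of component by a
    linear map, vanishing components stay zero and the others are kept in every chart. *)
Lemma comp_part b d k u v a : W u -> dom k u ->
  component b k u (projection d u v) a = if b == d then component b k u v a else 0.
Proof.
move=> Wu ku; have cu := dom_chart_at gA u; set c := chart_at A u in cu.
have [J JE] := comp_change Wu cu ku.
have E : \row_a component b k u (projection d u v) a =
    if b == d then \row_a component b k u v a else 0.
  rewrite JE.
  have -> : \row_a component b c u (projection d u v) a =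
      if b == d then \row_a component b c u v a else 0.
    apply/rowP => m; rewrite mxE part_def comp_sum_frame //; case: eqP => [->|_]; by rewrite mxE.
  by case: eqP => _; [exact: esym (JE b v)|rewrite linear0].
by have /rowP/(_ a) := E; rewrite mxE => ->; case: eqP; rewrite mxE.
Qed.

Lemma partE b k u v : W u -> dom k u ->
  projection b u v = \sum_a component b k u v a *: adapted_frame b k a u.
Proof.
move=> Wu ku; apply: (comp_inj ku) => d a.
apply: etrans (comp_part d b v a Wu ku) _.
apply: etrans (esym (comp_sum_frame d b _ a ku)).
by case: eqP => [->|_]; reflexivity.
Qed.

End Nonlinear.
End Frames.

(** * The connection of the global frame *)

Lemma free_codomP (R : fieldType) (V : vectType R) n (f : 'I_n -> V) :
  free [seq f i | i : 'I_n] ->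
  forall k : 'I_n -> R, \sum_i k i *: f i = 0 -> forall i, k i = 0.
Proof.
move=> fr k k0; have /freeP : free [tuple f i | i < n] by [].
apply; rewrite -[RHS]k0; apply: eq_bigr => i _.
by rewrite -tnth_nth tnth_mktuple.
Qed.

Lemma sum_delta (R : nzRingType) n (f : 'I_n -> R) a : \sum_e f e * (a == e)%:R = f a.
Proof.
by rewrite (bigD1 a) //= eqxx mulr1 big1 ?addr0 // => e; rewrite eq_sym => /negPf->; rewrite mulr0.
Qed.

(** [x *m invmx X] lists the coefficients of [x] on the rows of [X]; [J] carries this combination to
    the same combination of the rows of [Y]. *)
Lemma mulmx_inv_linear (R : comUnitRingType) n (J : {linear 'rV[R]_n -> 'rV[R]_n})
    (x y : 'rV[R]_n) (X Y : 'M[R]_n) : X \in unitmx -> Y \in unitmx ->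
  y = J x -> (forall j, row j Y = J (row j X)) -> y *m invmx Y = x *m invmx X.
Proof.
move=> uX uY -> JX; rewrite -[X in J X](mulmxKV uX) [X in J X]mulmx_sum_row linear_sum.
under eq_bigr do rewrite linearZ /= -JX.
by rewrite -mulmx_sum_row mulmxK.
Qed.

Section Parallelism.
Context {R : realType} {n : nat} {M : manifold R n}.
Local Notation TM := (tangent M).
Local Notation A := (tangent_charts M).
Local Notation TTM := ('rV[R]_n * 'rV[R]_n)%type.
Variable N : chart A -> 'I_n -> 'I_n -> TM -> R.
Variable W : set TM.
Variable lam : 'I_n -> TM -> TTM.
Hypothesis near_W : forall u, W u -> near_point A u W.
Hypothesis hN : nonlinear_connection N W.
Hypothesis hlam : eap_space N lam W.
Let gA := tangent_good_charts M.
Let B := pair_coordinates (rV_coordinates (R := R) n) (rV_coordinates n).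
Implicit Types (b d : bool) (k : chart A) (u w : TM) (v : TTM) (Y : TM -> TTM).
Local Notation comp := (component N).
Local Notation frame := (adapted_frame N).
Local Notation part := (projection N).

(** With [b] fixed, these are convertible to [lamh] or [lamv], their matrix and its inverse, so
    lemmas generic in [b] apply directly to both types. *)
Definition lam_comp b k (i a : 'I_n) u : R := comp b k u (lam i u) a.
Definition lam_mx b k u : 'M[R]_n := \matrix_(j, c) lam_comp b k j c u.
Definition lam_inv b k (i a : 'I_n) u : R := invmx (lam_mx b k u) a i.

(** The pairing with the dual coframe: the coefficient of [v] along the horizontal or vertical part
    of [lam i]. *)
Definition coef b u (i : 'I_n) v : R :=
  \sum_a comp b (chart_at A u) u v a * lam_inv b (chart_at A u) i a u.

Definition parallelism u v Y : TTM :=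
  \sum_b \sum_i dirder A u v (fun w => coef b w i (Y w)) *: part b u (lam i u).

Local Opaque component adapted_frame projection.

Lemma smooth_lam u i : W u -> smooth_field_at A u (lam i).
Proof. by case: hlam => + _ _; exact. Qed.

(** A vanishing combination of the rows is a vanishing combination of the parts of the [lam i],
    which are free. *)
Lemma lam_mx_unit b k u : W u -> dom k u -> lam_mx b k u \in unitmx.
Proof.
move=> Wu ku; rewrite -row_free_unit; apply: inj_row_free => r r0.
have fr : free [seq part b u (lam i u) | i : 'I_n].
  by case: hlam => _ + +; case: b {r0} => h1 h2; [exact: h1|exact: h2].
apply/rowP => i; rewrite [RHS]mxE; apply: (free_codomP fr) i.
apply: (comp_inj (N := N) ku) => d a; rewrite comp_sum.
transitivity (if d == b then (r *m lam_mx b k u) 0 a else 0); last first.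
  by rewrite r0 mxE comp0; case: eqP.
rewrite mxE; case: eqP => [->|db].
  by apply: eq_bigr => i _; rewrite compZ (comp_part hN) // eqxx mxE.
by rewrite big1 // => i _; rewrite compZ (comp_part hN) //; case: eqP => // _; rewrite mulr0.
Qed.

Lemma lam_mulV b k u i j : W u -> dom k u ->
  \sum_a lam_comp b k i a u * lam_inv b k j a u = (i == j)%:R.
Proof.
move=> Wu ku; have /matrixP/(_ i j) := mulmxV (lam_mx_unit b Wu ku).
by rewrite !mxE => <-; apply: eq_bigr => a _; rewrite [lam_mx _ _ _ _ _]mxE.
Qed.

Lemma lam_Vmul b k u a c : W u -> dom k u ->
  \sum_i lam_inv b k i a u * lam_comp b k i c u = (a == c)%:R.
Proof.
move=> Wu ku; have /matrixP/(_ a c) := mulVmx (lam_mx_unit b Wu ku).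
by rewrite !mxE => <-; apply: eq_bigr => i _; rewrite [lam_mx _ _ _ _ _]mxE.
Qed.

(** The coefficients do not depend on the chart, because one [J] moves the components of [v] and of
    every [lam j]. Hence [coef] can be differentiated in a fixed chart. *)
Lemma coefE b k u i v : W u -> dom k u ->
  coef b u i v = \sum_a comp b k u v a * lam_inv b k i a u.
Proof.
move=> Wu ku; have cu := dom_chart_at gA u; rewrite /coef; move: (chart_at A u) cu => c cu.
have [J JE] := comp_change hN Wu cu ku.
pose x k' : 'rV_n := \row_a comp b k' u v a.
have rowE k' j : row j (lam_mx b k' u) = \row_a comp b k' u (lam j u) a.
  by apply/rowP => a; rewrite !mxE.
have mulE k' : \sum_a comp b k' u v a * lam_inv b k' i a u =
    (x k' *m invmx (lam_mx b k' u)) 0 i.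
  by rewrite mxE; apply: eq_bigr => a _; rewrite mxE.
have JL j : row j (lam_mx b k u) = J (row j (lam_mx b c u)).
  by apply: etrans (rowE k j) _; apply: etrans (JE b (lam j u)) _; rewrite rowE.
have mE := mulmx_inv_linear (lam_mx_unit b Wu cu) (lam_mx_unit b Wu ku) (JE b v) JL.
apply: etrans (mulE c) _; apply: etrans _ (esym (mulE k)).
exact: (congr1 (fun r : 'rV[R]_n => r 0 i) (esym mE)).
Qed.

Lemma coefD b u i v v' : coef b u i (v + v') = coef b u i v + coef b u i v'.
Proof. by rewrite /coef -big_split; apply: eq_bigr => a _; rewrite compD mulrDl. Qed.

Lemma coefZ b u i s v : coef b u i (s *: v) = s * coef b u i v.
Proof. by rewrite /coef mulr_sumr; apply: eq_bigr => a _; rewrite compZ mulrA. Qed.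

Lemma sum_coef b u v : W u -> \sum_i coef b u i v *: part b u (lam i u) = part b u v.
Proof.
move=> Wu; have cu := dom_chart_at gA u.
apply: (comp_inj (N := N) cu) => d a; rewrite comp_sum (comp_part hN) //.
under eq_bigr do rewrite compZ (comp_part hN) //.
case: eqP => [->|db]; last by rewrite big1 // => i _; rewrite mulr0.
rewrite /coef; under eq_bigr do rewrite mulr_suml.
rewrite exchange_big.
transitivity (\sum_m comp b (chart_at A u) u v m * (a == m)%:R); last exact: sum_delta.
apply: eq_bigr => m _; rewrite eq_sym -(lam_Vmul b m a Wu cu) mulr_sumr.
by apply: eq_bigr => i _; rewrite mulrA.
Qed.

Lemma near_dom_W k u : W u -> dom k u -> near_point A u (fun w => W w /\ dom k w).
Proof. by move=> Wu ku; apply: near_pointI; [exact: near_W|exact: (near_point_dom gA)]. Qed.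

Lemma smooth_lam_comp b k i a u : W u -> dom k u -> smooth_at A u (lam_comp b k i a).
Proof. by move=> Wu ku; apply: (smooth_comp hN) => //; exact: smooth_lam. Qed.

Lemma smooth_lam_inv b k i a u : W u -> dom k u -> smooth_at A u (lam_inv b k i a).
Proof.
move=> Wu ku; apply: (smooth_at_invmx gA (B := lam_mx b k)); first exact: lam_mx_unit.
move=> j c; rewrite [X in smooth_at _ _ X](_ : _ = lam_comp b k j c).
  exact: smooth_lam_comp.
by apply/funext => w; rewrite mxE.
Qed.

Lemma smooth_coef b i u Y : W u -> smooth_field_at A u Y ->
  smooth_at A u (fun w => coef b w i (Y w)).
Proof.
move=> Wu sY; have cu := dom_chart_at gA u.
apply: (@smooth_at_eq _ _ _ _ _ (fun w => \sum_a
   comp b (chart_at A u) w (Y w) a * lam_inv b (chart_at A u) i a w)).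
  by apply: near_pointS (near_dom_W Wu cu) => w [Ww cw]; rewrite (coefE b i (Y w) Ww cw).
apply: smooth_at_sum => a _; apply: smooth_atM; last exact: smooth_lam_inv.
exact: (smooth_comp hN).
Qed.

Lemma smooth_part b u Y : W u -> smooth_field_at A u Y ->
  smooth_field_at A u (fun w => part b w (Y w)).
Proof.
move=> Wu sY; have cu := dom_chart_at gA u.
apply: (@smooth_field_eq _ _ _ _ _ (fun w => \sum_a
   comp b (chart_at A u) w (Y w) a *: frame b (chart_at A u) a w)).
  by apply: near_pointS (near_dom_W Wu cu) => w [Ww cw]; rewrite (partE hN b (Y w) Ww cw).
apply: (smooth_field_sum gA B) => a _.
apply: (smooth_fieldZ gA B).
  exact: (smooth_comp hN).
exact: (smooth_frame hN).
Qed.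

Lemma parallelism_connection : linear_connection A W parallelism.
Proof.
split=> [u s v v' Y Wu sY|u v Y Z Wu sY sZ|u v f Y Wu sf sY|u v Y Z Wu sY sZ YZ|u X Y Wu sX sY].
- rewrite /parallelism scaler_sumr -big_split; apply: eq_bigr => b _ /=.
  rewrite scaler_sumr -big_split; apply: eq_bigr => i _ /=.
  by rewrite (dirder_is_linear A u _ s v v') scalerDl -scalerA.
- rewrite /parallelism -big_split; apply: eq_bigr => b _ /=.
  rewrite -big_split; apply: eq_bigr => i _ /=; rewrite -scalerDl; congr (_ *: _).
  rewrite -dirderD; [|exact: smooth_coef|exact: smooth_coef].
  by congr dirder; apply/funext => w; exact: coefD.
- have dE b i : dirder A u v (fun w => coef b w i (f w *: Y w)) =
      f u * dirder A u v (fun w => coef b w i (Y w)) + dirder A u v f * coef b u i (Y u).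
    apply: etrans _ (dirderM gA v sf (smooth_coef b i Wu sY)).
    by apply: (congr1 (dirder A u v)); apply/funext => w; exact: coefZ.
  (* The terms in [dirder A u v f] reassemble into [Y u] through its expansion in the global
     frame. *)
  have YE : Y u = \sum_b \sum_i coef b u i (Y u) *: part b u (lam i u).
    apply: etrans (esym (sum_part N u (Y u))) _.
    by apply: eq_bigr => b _; exact: esym (sum_coef b (Y u) Wu).
  rewrite [X in _ = _ *: X + _]YE !scaler_sumr -big_split; apply: eq_bigr => b _.
  rewrite [X in _ = X + _]scaler_sumr [X in _ = _ + X]scaler_sumr -big_split.
  apply: eq_bigr => i _ /=.
  by rewrite dE scalerDl !scalerA addrC.
- apply: eq_bigr => b _; apply: eq_bigr => i _.
  apply: (congr1 (fun s => s *: part b u (lam i u))).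
  apply: dirder_eq; last exact: smooth_coef.
  by apply: near_pointS YZ => w ->.
- apply: (smooth_field_sum gA B) => b _; apply: (smooth_field_sum gA B) => i _.
  apply: (smooth_fieldZ gA B); last by apply: smooth_part => //; exact: smooth_lam.
  by apply: (smooth_at_dirder gA B) => //; exact: smooth_coef.
Qed.

Lemma comp_parallelism b k u v Y a : W u -> dom k u ->
  comp b k u (parallelism u v Y) a =
  \sum_i dirder A u v (fun w => coef b w i (Y w)) * lam_comp b k i a u.
Proof.
move=> Wu ku; rewrite /parallelism comp_sum (bigD1 b) //= [X in _ + X]big1 => [|d db].
  by rewrite addr0 comp_sum; apply: eq_bigr => i _; rewrite compZ (comp_part hN) // eqxx.
rewrite comp_sum big1 // => i _; rewrite compZ (comp_part hN) //.
by rewrite eq_sym (negPf db) mulr0.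
Qed.

(** The coefficient of [frame b k m] along the [i]-th field is [lam_inv b k i m]; the connection
    coefficients are thus derivatives of the dual coframe contracted with the frame. *)
Lemma comp_parallelism_frame b k u v m a : W u -> dom k u ->
  comp b k u (parallelism u v (frame b k m)) a =
  \sum_i dirder A u v (lam_inv b k i m) * lam_comp b k i a u.
Proof.
move=> Wu ku; apply: etrans (comp_parallelism b v _ a Wu ku) _.
apply: eq_bigr => i _; apply: (congr1 ( *%R^~ (lam_comp b k i a u))).
apply: dirder_eq; last exact: smooth_lam_inv.
apply: near_pointS (near_dom_W Wu ku) => w [Ww kw]; rewrite (coefE b i _ Ww kw).
rewrite (bigD1 m) //= big1 => [|a' am]; rewrite comp_frame // !eqxx ?mul1r ?addr0 //.
by rewrite (negPf am) mul0r.
Qed.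

Definition preserves_span (D : TM -> TTM -> (TM -> TTM) -> TTM) : Prop :=
  forall b u v Y, W u -> smooth_field_at A u Y ->
    near_point A u (fun w => span N b (chart_at A w) w (Y w)) ->
    span N b (chart_at A u) u (D u v Y).

Lemma d_connectionP (D : TM -> TTM -> (TM -> TTM) -> TTM) :
  d_connection N W D <-> linear_connection A W D /\ preserves_span D.
Proof.
split=> [[lD hD vD]|[lD sD]]; first by split=> // -[]; [exact: hD|exact: vD].
by split=> //; [exact: (sD true)|exact: (sD false)].
Qed.

(** If the components of one type vanish near [u], so do the coefficients of that type, and then
    their derivatives at [u]. *)
Lemma parallelism_d_connection : d_connection N W parallelism.
Proof.
apply/d_connectionP; split; first exact: parallelism_connection.
move=> b u v Y Wu sY spY; have cu := dom_chart_at gA u.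
apply/(spanP N b _ cu) => a; rewrite comp_parallelism // big1 // => i _.
have cw w := dom_chart_at gA w.
have c0 : near_point A u (fun w => 0 = coef (~~ b) w i (Y w)).
  apply: near_pointS spY => w /(spanP N b _ (cw w)) Y0.
  by rewrite /coef big1 // => m _; rewrite Y0 mul0r.
by rewrite (dirder_eq v c0 (smooth_at_cst u 0)) dirder_cst mul0r.
Qed.

(* All four families of vanishing covariant derivatives at once: [b] selects the
   component of the fields [lam i], [d] the direction of differentiation. *)
Definition parallel_frame (D : TM -> TTM -> (TM -> TTM) -> TTM) : Prop :=
  forall b d k u, W u -> dom k u -> forall i a m : 'I_n,
    dirder A u (frame d k m u) (lam_comp b k i a) +
    \sum_e lam_comp b k i e u * comp b k u (D u (frame d k m u) (frame b k e)) a = 0.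

(** Expand the field in the adapted frame and apply the Leibniz rule along each frame direction.
    Components of type [b] vanish by [parallel_frame], those of the other type because [D] preserves
    the distribution; linearity in the direction concludes. *)
Lemma parallel_part D : d_connection N W D -> parallel_frame D ->
  forall b i u v, W u -> D u v (fun w => part b w (lam i w)) = 0.
Proof.
move=> /d_connectionP[lD sD] pD b i u v Wu; have cu := dom_chart_at gA u.
pose c := chart_at A u; rewrite -/c in cu.
have sp : smooth_field_at A u (fun w => part b w (lam i w)).
  by apply: smooth_part => //; exact: smooth_lam.
have sf a : smooth_field_at A u (frame b c a) by exact: (smooth_frame hN).
have sl a : smooth_at A u (lam_comp b c i a) by exact: smooth_lam_comp.
have lE : near_point A u (fun w =>
    part b w (lam i w) = \sum_a lam_comp b c i a w *: frame b c a w).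
  by apply: near_pointS (near_dom_W Wu cu) => w [Ww cw]; exact: (partE hN b (lam i w) Ww cw).
have ss : smooth_field_at A u (fun w => \sum_a lam_comp b c i a w *: frame b c a w).
  by apply: (smooth_field_sum gA B) => a _; exact: (smooth_fieldZ gA B).
(* The expansion in the frame of [c] is valid only near [u], so locality of [D] is what allows the
   replacement. *)
have Dl : forall v', D u v' (fun w => part b w (lam i w)) =
    D u v' (fun w => \sum_a lam_comp b c i a w *: frame b c a w).
  by move=> v'; case: lD => _ _ _ Dloc _; exact: Dloc.
have D_span v' a : span N b c u (D u v' (frame b c a)).
  apply: sD => //; apply: near_pointS (near_dom_W Wu cu) => w [Ww cw].
  rewrite (span_change hN b Ww (dom_chart_at gA w) cw).
  by apply/(spanP N b _ cw) => m; rewrite comp_frame //; case: (b).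
have D0 d m : D u (frame d c m u) (fun w => part b w (lam i w)) = 0.
  rewrite Dl (connection_sumZ gA B lD) //.
  apply: (comp_inj (N := N) cu) => b' a; rewrite comp0 comp_sum.
  case: (eqVneq b' b) => [->|bb'].
    rewrite -[RHS](pD b d c u Wu cu i a m) (eq_bigr (fun e =>
      dirder A u (frame d c m u) (lam_comp b c i e) * (a == e)%:R +
      lam_comp b c i e u * comp b c u (D u (frame d c m u) (frame b c e)) a)).
      by rewrite big_split /= sum_delta.
    by move=> e _; rewrite compD !compZ comp_frame // eqxx.
  have b'E : b' = ~~ b by case: (b) (b') bb' => -[].
  rewrite big1 // => e _; rewrite compD !compZ comp_frame // (negPf bb') mulr0 add0r.
  by rewrite b'E ((spanP N b _ cu).1 (D_span _ e) a) mulr0.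
rewrite (frame_decomposition N v cu) big_bool /=.
have D_sum b' : D u (\sum_a comp b' c u v a *: frame b' c a u)
    (fun w => part b w (lam i w)) = 0.
  by rewrite (connection_dir_sum lD) // big1 // => a _; rewrite D0 scaler0.
case: lD => Dv _ _ _ _; rewrite -[X in D u (X + _)]scale1r Dv // scale1r.
by rewrite !D_sum addr0.
Qed.

(** By locality [Y] may be replaced by its expansion in the global frame. In the Leibniz rule the
    frame fields contribute nothing, by [parallel_part], and the derivatives of the coefficients
    remain. *)
Lemma parallelism_unique D : d_connection N W D -> parallel_frame D ->
  same_connection A W D parallelism.
Proof.
move=> dD pD u v Y Wu sY; have [lD _] := (d_connectionP D).1 dD.
pose X b i w := part b w (lam i w).
have sX b i : smooth_field_at A u (X b i).
  by apply: smooth_part => //; exact: smooth_lam.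
have sXs b : smooth_field_at A u (fun w => \sum_i coef b w i (Y w) *: X b i w).
  by apply: (smooth_field_sum gA B) => i _; apply: (smooth_fieldZ gA B) => //; exact: smooth_coef.
have YE : near_point A u (fun w => Y w =
    \sum_i coef true w i (Y w) *: X true i w + \sum_i coef false w i (Y w) *: X false i w).
  apply: near_pointS (near_W Wu) => w Ww.
  by rewrite !(sum_coef _ _ Ww) -[LHS](sum_part N w) big_bool.
have sS : smooth_field_at A u (fun w =>
    \sum_i coef true w i (Y w) *: X true i w + \sum_i coef false w i (Y w) *: X false i w).
  exact: smooth_field_eq YE sY.
case: (lD) => _ DD _ Dloc _; rewrite (Dloc u v _ _ Wu sY sS YE) DD //.
rewrite /parallelism big_bool; congr (_ + _).
  rewrite (connection_sumZ gA B lD) //; last by move=> i; exact: smooth_coef.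
  by apply: eq_bigr => i _; rewrite (parallel_part dD pD) // scaler0 addr0.
rewrite (connection_sumZ gA B lD) //; last by move=> i; exact: smooth_coef.
by apply: eq_bigr => i _; rewrite (parallel_part dD pD) // scaler0 addr0.
Qed.

Definition lam_metric b k (a c : 'I_n) u : R := \sum_i lam_inv b k i a u * lam_inv b k i c u.

(** * Connection coefficients as matrix products *)

Section Coefficients.
Variables (b : bool) (k : chart A) (u : TM) (v : TTM).
Hypotheses (Wu : W u) (ku : dom k u).
(** Entrywise derivatives along [v] of the frame matrix [L] and of its inverse [I], indexed like
    them; the identities below become matrix algebra. *)
Let dL : 'M[R]_n := \matrix_(i, a) dirder A u v (lam_comp b k i a).
Let dI : 'M[R]_n := \matrix_(a, i) dirder A u v (lam_inv b k i a).
Let L := lam_mx b k u.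
Let I := invmx L.

Lemma comp_parallelismE m a :
  comp b k u (parallelism u v (frame b k m)) a = (dI *m L) m a.
Proof.
rewrite comp_parallelism_frame // [RHS]mxE; apply: eq_bigr => i _.
by rewrite !mxE.
Qed.

(** Differentiate [L *m I = 1], which holds near [u]. *)
Lemma dirder_lam_mx : dL *m I = - (L *m dI).
Proof.
apply/eqP; rewrite -addr_eq0; apply/eqP/matrixP => i j; rewrite !mxE.
have c0 : near_point A u (fun w => (i == j)%:R = \sum_a lam_comp b k i a w * lam_inv b k j a w).
  by apply: near_pointS (near_dom_W Wu ku) => w [Ww kw]; rewrite (lam_mulV b i j Ww kw).
have := dirder_eq v c0 (smooth_at_cst u _); rewrite dirder_cst => d0.
rewrite -[RHS]d0 dirder_sum; last first.
  by move=> a _; apply: smooth_atM; [exact: smooth_lam_comp|exact: smooth_lam_inv].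
rewrite addrC -big_split; apply: eq_bigr => a _.
apply: etrans _ (esym (dirderM gA v (smooth_lam_comp b i a Wu ku) (smooth_lam_inv b j a Wu ku))).
by rewrite !mxE.
Qed.

Lemma parallelism_lam_comp i a :
  dirder A u v (lam_comp b k i a) +
  \sum_e lam_comp b k i e u * comp b k u (parallelism u v (frame b k e)) a = 0.
Proof.
have LU := lam_mx_unit b Wu ku.
have /matrixP/(_ i a) : dL + L *m (dI *m L) = 0.
  by rewrite mulmxA -[L *m dI]opprK -dirder_lam_mx mulNmx mulmxKV // subrr.
rewrite !mxE => E; rewrite -[RHS]E; congr (_ + _); apply: eq_bigr => e _.
by rewrite comp_parallelismE !mxE.
Qed.

(** With [G0] the transpose of [G], the difference in parentheses is an entry of [dI - G0 *m I];
    multiplication by [L] on the right makes it [dI *m L - G0], for any [G] whatever. *)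
Lemma parallelism_coefficient (G : 'I_n -> 'I_n -> R) a m :
  comp b k u (parallelism u v (frame b k m)) a =
  G a m + \sum_i lam_comp b k i a u *
    (dirder A u v (lam_inv b k i m) - \sum_e lam_inv b k i e u * G e m).
Proof.
have LU := lam_mx_unit b Wu ku; pose G0 : 'M[R]_n := \matrix_(m, a) G a m.
have /matrixP/(_ m a) : dI *m L = G0 + (dI - G0 *m I) *m L.
  by rewrite mulmxBl mulmxKV // addrC subrK.
rewrite comp_parallelismE => ->; rewrite 2!mxE; congr (_ + _).
rewrite mxE; apply: eq_bigr => i _; rewrite mulrC !mxE; congr (_ * (_ - _)).
by apply: eq_bigr => e _; rewrite mulrC !mxE.
Qed.

(** The metric is [I *m I^T], with derivative [I *m dI^T + dI *m I^T]. Since the coefficients form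
    [dI *m L], cancelling [L] against [I] shows that the two contractions are exactly these two
    terms. *)
Lemma parallelism_metric i j :
  dirder A u v (lam_metric b k i j)
  - \sum_e lam_metric b k e j u * comp b k u (parallelism u v (frame b k i)) e
  - \sum_e lam_metric b k i e u * comp b k u (parallelism u v (frame b k j)) e = 0.
Proof.
have LU := lam_mx_unit b Wu ku.
have gE a c : lam_metric b k a c u = (I *m I^T) a c.
  by rewrite mxE; apply: eq_bigr => l _; rewrite !mxE.
have dg : dirder A u v (lam_metric b k i j) = (I *m dI^T + dI *m I^T) i j.
  rewrite /lam_metric dirder_sum; last by move=> l _; apply: smooth_atM; exact: smooth_lam_inv.
  rewrite !mxE -big_split; apply: eq_bigr => l _.
  apply: etrans (dirderM gA v (smooth_lam_inv b l i Wu ku) (smooth_lam_inv b l j Wu ku)) _.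
  by rewrite !mxE.
have E1 : dI *m L *m (I *m I^T) = dI *m I^T by rewrite mulmxA mulmxK.
have E2 : I *m I^T *m (dI *m L)^T = I *m dI^T.
  by rewrite trmx_mul !mulmxA -[I *m I^T *m L^T]mulmxA -trmx_mul mulmxV // trmx1 mulmx1.
have S1 : \sum_e lam_metric b k e j u * comp b k u (parallelism u v (frame b k i)) e =
    (dI *m I^T) i j.
  rewrite -E1 [RHS]mxE; apply: eq_bigr => e _.
  by rewrite comp_parallelismE gE mulrC.
have S2 : \sum_e lam_metric b k i e u * comp b k u (parallelism u v (frame b k j)) e =
    (I *m dI^T) i j.
  rewrite -E2 [RHS]mxE; apply: eq_bigr => e _.
  by rewrite comp_parallelismE gE [(dI *m L)^T e j]mxE.
apply: etrans (f_equal2 (fun x y => dirder A u v (lam_metric b k i j) - x - y) S1 S2) _.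
by rewrite dg [X in X - _ - _]mxE addrK subrr.
Qed.

End Coefficients.
End Parallelism.

Theorem theorem2p1 (R : realType) (n : nat) (M : manifold R n)
    (W : set (tangent M)) (hW : W = setT \/ W = slit M)
    (N : chart (tangent_charts M) -> 'I_n -> 'I_n -> tangent M -> R)
    (hN : nonlinear_connection N W)
    (lam : 'I_n -> tangent M -> 'rV[R]_n * 'rV[R]_n)
    (hlam : eap_space N lam W) :
  exists D : tangent M -> 'rV[R]_n * 'rV[R]_n ->
             (tangent M -> 'rV[R]_n * 'rV[R]_n) -> 'rV[R]_n * 'rV[R]_n,
  [/\ d_connection N W D /\ parallel_lam N lam W D,
      forall D', d_connection N W D' -> parallel_lam N lam W D' ->
        same_connection (tangent_charts M) W D' D,
      metric_connection N lam W D
    & forall (k : chart (tangent_charts M)) u, W u -> dom k u ->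
      [/\ forall al mu nu, Gh (coefs_of N D k) al mu nu u =
            Gh (natural N lam k) al mu nu u +
            \sum_i lamh lam k i al u *
              hlow_h N k (natural N lam k) (lamh_inv lam k i) mu nu u,
          forall a b nu, Gv (coefs_of N D k) a b nu u =
            Gv (natural N lam k) a b nu u +
            \sum_i lamv N lam k i a u *
              vlow_h N k (natural N lam k) (lamv_inv N lam k i) b nu u,
          forall al mu c, Ch (coefs_of N D k) al mu c u =
            Ch (natural N lam k) al mu c u +
            \sum_i lamh lam k i al u *
              hlow_v k (natural N lam k) (lamh_inv lam k i) mu c u
        & forall a b c, Cv (coefs_of N D k) a b c u =
            Cv (natural N lam k) a b c u +
            \sum_i lamv N lam k i a u *
              vlow_v k (natural N lam k) (lamv_inv N lam k i) b c u]].
Proof.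
(* Either choice of [W] contains a neighbourhood of each of its points. *)
have nW u := near_slit hW (u := u).
exists (parallelism N lam); split.
- split; first exact: parallelism_d_connection.
  move=> k u Wu ku i j l; split.
  (* The four families are one generic identity: the boolean selects the type of component, [delta]
     or [vdot] the direction. *)
  + exact: (parallelism_lam_comp nW hN hlam true (delta N k l u) Wu ku i j).
  + exact: (parallelism_lam_comp nW hN hlam true (vdot k l u) Wu ku i j).
  + exact: (parallelism_lam_comp nW hN hlam false (delta N k l u) Wu ku i j).
  + exact: (parallelism_lam_comp nW hN hlam false (vdot k l u) Wu ku i j).
- move=> D' dD' pD'; apply: parallelism_unique => // b d k u Wu ku i a m.
  have [hh hv vh vv] := pD' k u Wu ku i a m.
  by case: b; case: d; [exact: hh|exact: hv|exact: vh|exact: vv].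
- move=> k u Wu ku i j l; split.
  + exact: (parallelism_metric nW hN hlam true (delta N k l u) Wu ku i j).
  + exact: (parallelism_metric nW hN hlam true (vdot k l u) Wu ku i j).
  + exact: (parallelism_metric nW hN hlam false (delta N k l u) Wu ku i j).
  + exact: (parallelism_metric nW hN hlam false (vdot k l u) Wu ku i j).
- move=> k u Wu ku; split=> a m l.
  (* The arbitrary coefficients [G] are taken from [natural], with the direction index [l] fixed. *)
  + exact: (parallelism_coefficient nW hN hlam true (delta N k l u) Wu ku
      (fun e f => Gh (natural N lam k) e f l u) a m).
  + exact: (parallelism_coefficient nW hN hlam false (delta N k l u) Wu ku
      (fun e f => Gv (natural N lam k) e f l u) a m).
  + exact: (parallelism_coefficient nW hN hlam true (vdot k l u) Wu ku
      (fun e f => Ch (natural N lam k) e f l u) a m).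
  + exact: (parallelism_coefficient nW hN hlam false (vdot k l u) Wu ku
      (fun e f => Cv (natural N lam k) e f l u) a m).
Qed.
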